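(* If $\pi$ is a (regular) $\mathbf{LK}$-proof of a sequent $\Gamma$, then $\mathrm{Exp}(\pi)$ is an expansion proof of $\Gamma$ (i.e. an expansion proof $\mathcal{P}$ with $\mathrm{Sh}(\mathcal{P})=\Gamma$). If $\pi$ is cut-free, then so is $\mathrm{Exp}(\pi)$.
   Context: Classical first-order logic; formulas in negation normal form, $\overline{A}$ the de Morgan dual, a literal is an atom or negated atom; a sequent is a finite set of formulas. Expansion trees $E$ and shallow formula $\mathrm{Sh}(E)$: (i) a literal $L$, $\mathrm{Sh}(L)=L$; (ii) $E_1\circ E_2$ for $\circ\in\{\wedge,\vee\}$, $\mathrm{Sh}=\mathrm{Sh}(E_1)\circ\mathrm{Sh}(E_2)$; (iii) for a set of terms $\{t_1,\dots,t_n\}$ and $E_i$ with $\mathrm{Sh}(E_i)=A[x\backslash t_i]$, $\exists x\,A+^{t_1}E_1\cdots+^{t_n}E_n$ with shallow formula $\exists x\,A$; (iv) for $E_0$ with $\mathrm{Sh}(E_0)=A[x\backslash y]$, $y$ a variable, $\forall x\,A+^{y}E_0$ with shallow formula $\forall x\,A$. The $+^{t_i}$ are $\exists$-expansions, $+^{y}$ a $\forall$-expansion with eigenvariable $y$; an expansion dominates all expansions in the subtree attached to it. Deep formula: $\mathrm{Dp}(L)=L$, $\mathrm{Dp}(E_1\circ E_2)=\mathrm{Dp}(E_1)\circ\mathrm{Dp}(E_2)$, $\mathrm{Dp}(\exists x\,A+^{t_1}E_1\cdots+^{t_n}E_n)=\bigvee_i\mathrm{Dp}(E_i)$, $\mathrm{Dp}(\forall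 x\,A+^{y}E_0)=\mathrm{Dp}(E_0)$. A formula is positive if its top symbol is $\vee$ or $\exists$ or it is a positive literal. A cut is a pair $(E^+,E^-)$ of expansion trees with $\mathrm{Sh}(E^+)=\overline{\mathrm{Sh}(E^-)}$ positive (the cut-formula); $\mathrm{Dp}$ of a cut is $\mathrm{Dp}(E^+)\wedge\mathrm{Dp}(E^-)$. An expansion pre-proof $\mathcal{P}=\mathcal{C},\mathcal{E}$: a set of cuts with pairwise distinct cut-formulas and a set $\mathcal{E}$ of expansion trees with pairwise distinct shallow formulas, distinct $\forall$-expansions having distinct eigenvariables, and $\mathrm{Sh}(\mathcal{P}):=\mathrm{Sh}(\mathcal{E})$ without free variables; $\mathrm{Dp}(\mathcal{P})$ is the sequent $\mathrm{Dp}(\mathcal{E}),\mathrm{Dp}(\mathcal{C})$. The dependency relation $<_{\mathcal{P}}$ is the transitive closure of the least relation $<^0$ on expansions and cuts with: $v<^0w$ if $w$ is an $\exists$-expansion whose term contains the eigenvariable of the $\forall$-expansion $v$; $v<^0w$ if $v$ dominates $w$; $C<^0v$ if $v$ is an expansion in cut $C$; $v<^0C$ if the cut-formula of $C$ contains the eigenvariable of the $\forall$-expansion $v$. An expansion proof is a pre-proof with $<_{\mathcal{P}}$ acyclic and $\mathrm{Dp}(\mathcal{P})$ a tautology; it is cut-free if it has no cuts. For expansion trees $E_1,E_2$ with equal shallow formula, $E_1\cup E_2$ is their merge (recursively: literals $L\cup L=L$, $(E_1'\circ E_1'')\cup(E_2'\circ E_2'')=(E_1'\cup E_2')\circ(E_1''\cup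 E_2'')$, $\forall$-trees are merged by globally renaming the second eigenvariable to the first and merging the subtrees, $\exists$-trees by taking the union of the instances, merging the subtrees of common instance terms), extended to pre-proofs by merging trees/cuts with the same shallow formula (cuts componentwise) and taking the union of the others. The calculus $\mathbf{LK}$ on sequents: initial sequents $\Gamma,A,\overline{A}$ with $A$ an atom; rules: from $\Gamma,A[x\backslash\alpha]$ infer $\Gamma,\forall x\,A$ ($\alpha$ not in $\Gamma,\forall x\,A$); from $\Gamma,\exists x\,A,A[x\backslash t]$ infer $\Gamma,\exists x\,A$; from $\Gamma,A$ and $\Gamma,B$ infer $\Gamma,A\wedge B$; from $\Gamma,A,B$ infer $\Gamma,A\vee B$; from $\Gamma,A$ and $\overline{A},\Gamma$ infer $\Gamma$ (cut). An $\mathbf{LK}$-proof is regular if distinct $\forall$-inferences have distinct eigenvariables; all $\mathbf{LK}$-proofs are assumed regular. For a formula $A$, $A^{\mathrm{E}}$ is the natural coercion of $A$ into an expansion tree of $A$, and $(A_1,\dots,A_n)^{\mathrm{E}}=A_1^{\mathrm{E}},\dots,A_n^{\mathrm{E}}$. $\mathrm{Exp}(\pi)$ is defined by induction: initial sequent $\Gamma,A,\overline{A}$ gives $\Gamma^{\mathrm{E}},A,\overline{A}$; $\wedge$ with premises' $\mathrm{Exp}$ equal to $\mathcal{P}_A,E_A$ and $\mathcal{P}_B,E_B$ ($\mathrm{Sh}(E_A)=A$, $\mathrm{Sh}(E_B)=B$) gives $\mathcal{P}_A\cup\mathcal{P}_B,E_A\wedge E_B$; $\vee$ with premise $\mathcal{P},E_A,E_B$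 gives $\mathcal{P},E_A\vee E_B$; $\forall$ with premise $\mathcal{P},E$ ($\mathrm{Sh}(E)=A[x\backslash\alpha]$) gives $\mathcal{P},\forall x\,A+^{\alpha}E$; $\exists$ with premise $\mathcal{P},E,E_t$ ($\mathrm{Sh}(E)=\exists x\,A$, $\mathrm{Sh}(E_t)=A[x\backslash t]$) gives $\mathcal{P},E\cup(\exists x\,A+^{t}E_t)$; cut on positive $A$ with premises $\mathcal{P}^+,E^+$ and $\mathcal{P}^-,E^-$ ($\mathrm{Sh}(E^+)=A$, $\mathrm{Sh}(E^-)=\overline{A}$) gives $(E^+,E^-),\mathcal{P}^+\cup\mathcal{P}^-$.
   Formalization: Regular also requires each eigenvariable to occur only above its ∀-inference (distinctness alone allows cyclic Exp(π)); Γ has no free variables; when an active formula A also lies in the context Γ, Exp keeps a fresh coercion A^E for the context copy. *)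

(* Defs.v *)
From HB Require Import structures.
From mathcomp Require Import all_boot finmap.
From Stdlib Require Import Relation_Operators.

Set Implicit Arguments.
Unset Strict Implicit.
Unset Printing Implicit Defensive.

Local Open Scope fset_scope.

(* Syntax is well-scoped de Bruijn for bound variables (so alpha-equivalent
   formulas are equal and no capture can occur) and named, by nat, for free
   variables: [term n] and [formula n] have the n bound variables 'I_n in scope,
   0 being the innermost. Terms and formulas proper are [term 0], [formula 0],
   and the body of a quantifier is a [formula 1]. Arities are not enforced: a
   symbol together with its number of arguments is to be seen as the actual
   symbol, so that every first-order language is covered. *)

Inductive conn := Conj | Disj.

Section Syntax.
Variables Fs Ps : choiceType.

Inductive term (n : nat) :=
  BVar of 'I_n | FVar of nat | Fn of Fs & seq (term n).

(* [Lit true p ts] is an atom, [Lit false p ts] a negated atom. *)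
Inductive formula (n : nat) :=
  | Lit of bool & Ps & seq (term n)
  | Bin of conn & formula n & formula n
  | Ex of formula n.+1
  | All of formula n.+1.

Fixpoint term_nested_ind n (P : term n -> Prop) (HB : forall i, P (BVar i))
    (HF : forall x, P (FVar n x))
    (HA : forall f ts, foldr (fun t Q => P t /\ Q) True ts -> P (Fn f ts))
    (t : term n) : P t :=
  match t with
  | BVar i => HB i
  | FVar x => HF x
  | Fn f ts => HA f ts
      ((fix go s : foldr (fun t Q => P t /\ Q) True s :=
          if s is u :: s' then conj (term_nested_ind HB HF HA u) (go s')
          else I) ts)
  end.

Fixpoint enc_term n (t : term n) : GenTree.tree (Fs + Ps) :=
  match t with
  | BVar i => GenTree.Node 0 [:: GenTree.Node i [::]]
  | FVar x => GenTree.Node 1 [:: GenTree.Node x [::]]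
  | Fn f ts => GenTree.Node 2 (GenTree.Leaf (inl f) :: map (@enc_term n) ts)
  end.

Fixpoint dec_term n (t : GenTree.tree (Fs + Ps)) : option (term n) :=
  match t with
  | GenTree.Node 0 [:: GenTree.Node i [::]] => omap (@BVar n) (insub i)
  | GenTree.Node 1 [:: GenTree.Node x [::]] => Some (FVar n x)
  | GenTree.Node 2 (GenTree.Leaf (inl f) :: ts) =>
      Some (Fn f (pmap (@dec_term n) ts))
  | _ => None
  end.

Lemma enc_termK n : pcancel (@enc_term n) (@dec_term n).
Proof.
elim/term_nested_ind => [i|x|f ts IH] //=; first by rewrite valK.
by congr (Some (Fn f _)); elim: ts IH => //= t ts IHts [-> /IHts ->].
Qed.

HB.instance Definition _ n := Choice.copy (term n) (pcan_type (@enc_termK n)).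

Fixpoint enc_formula n (A : formula n) : GenTree.tree (Fs + Ps) :=
  match A with
  | Lit b p ts => GenTree.Node b (GenTree.Leaf (inr p) :: map (@enc_term n) ts)
  | Bin c A B =>
      GenTree.Node (if c is Conj then 2 else 3) [:: enc_formula A; enc_formula B]
  | Ex A => GenTree.Node 4 [:: enc_formula A]
  | All A => GenTree.Node 5 [:: enc_formula A]
  end.

Fixpoint dec_formula n (t : GenTree.tree (Fs + Ps)) : option (formula n) :=
  match t with
  | GenTree.Node 0 (GenTree.Leaf (inr p) :: ts) =>
      Some (Lit false p (pmap (@dec_term n) ts))
  | GenTree.Node 1 (GenTree.Leaf (inr p) :: ts) =>
      Some (Lit true p (pmap (@dec_term n) ts))
  | GenTree.Node 2 [:: t1; t2] =>
      obind (fun A => omap (Bin Conj A) (dec_formula n t2)) (dec_formula n t1)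
  | GenTree.Node 3 [:: t1; t2] =>
      obind (fun A => omap (Bin Disj A) (dec_formula n t2)) (dec_formula n t1)
  | GenTree.Node 4 [:: t1] => omap (@Ex n) (dec_formula n.+1 t1)
  | GenTree.Node 5 [:: t1] => omap (@All n) (dec_formula n.+1 t1)
  | _ => None
  end.

Lemma enc_formulaK n : pcancel (@enc_formula n) (@dec_formula n).
Proof.
elim=> {}n => [b p ts|[] A IHA B IHB|A IHA|A IHA] /=.
- by case: b; rewrite /= (map_pK (@enc_termK n)).
- by rewrite IHA /= IHB.
- by rewrite IHA /= IHB.
- by rewrite IHA.
- by rewrite IHA.
Qed.

HB.instance Definition _ n :=
  Choice.copy (formula n) (pcan_type (@enc_formulaK n)).

Fixpoint fv_term n (t : term n) : seq nat :=
  match t with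
  | BVar _ => [::]
  | FVar x => [:: x]
  | Fn _ ts => flatten (map (@fv_term n) ts)
  end.

Fixpoint fv n (A : formula n) : seq nat :=
  match A with
  | Lit _ _ ts => flatten (map (@fv_term n) ts)
  | Bin _ A B => fv A ++ fv B
  | Ex A => fv A
  | All A => fv A
  end.

Fixpoint subst_term m n (s : 'I_m -> term n) (t : term m) : term n :=
  match t with
  | BVar i => s i
  | FVar x => FVar n x
  | Fn f ts => Fn f (map (subst_term s) ts)
  end.

Definition scons n (T : Type) (x : T) (s : 'I_n -> T) (i : 'I_n.+1) : T :=
  if unlift ord0 i is Some j then s j else x.

Definition up m n (s : 'I_m -> term n) : 'I_m.+1 -> term n.+1 :=
  scons (BVar ord0) (fun j => subst_term (fun i => BVar (lift ord0 i)) (s j)).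

Fixpoint subst m n (s : 'I_m -> term n) (A : formula m) : formula n :=
  match A with
  | Lit b p ts => Lit b p (map (subst_term s) ts)
  | Bin c A B => Bin c (subst s A) (subst s B)
  | Ex A => Ex (subst (up s) A)
  | All A => All (subst (up s) A)
  end.

(* A[x\t], where A is the body of a quantifier binding x *)
Definition inst (A : formula 1) (t : term 0) : formula 0 := subst (fun=> t) A.

Fixpoint ren_term n (r : nat -> nat) (t : term n) : term n :=
  match t with
  | BVar i => BVar i
  | FVar x => FVar n (r x)
  | Fn f ts => Fn f (map (ren_term r) ts)
  end.

Fixpoint ren n (r : nat -> nat) (A : formula n) : formula n :=
  match A with
  | Lit b p ts => Lit b p (map (ren_term r) ts)
  | Bin c A B => Bin c (ren r A) (ren r B)
  | Ex A => Ex (ren r A)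
  | All A => All (ren r A)
  end.

Fixpoint dual n (A : formula n) : formula n :=
  match A with
  | Lit b p ts => Lit (~~ b) p ts
  | Bin Conj A B => Bin Disj (dual A) (dual B)
  | Bin Disj A B => Bin Conj (dual A) (dual B)
  | Ex A => All (dual A)
  | All A => Ex (dual A)
  end.

Definition positive n (A : formula n) : bool :=
  match A with
  | Lit b _ _ => b
  | Bin Disj _ _ => true
  | Bin Conj _ _ => false
  | Ex _ => true
  | All _ => false
  end.

Definition sequent := {fset formula 0}.

Definition fv_seq (G : sequent) : seq nat := flatten [seq fv A | A <- G].

Definition closed_sequent (G : sequent) : Prop := fv_seq G = [::].

(* The same notion of tree underlies well-formed and ill-formed expansion
   trees; see [is_etree] for the conditions on shallow formulas. *)
Inductive etree :=
  | ELit of bool & Ps & seq (term 0)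
  | EBin of conn & etree & etree
  | EEx of formula 1 & seq (term 0 * etree)
  | EAll of formula 1 & nat & etree.

Fixpoint Sh (E : etree) : formula 0 :=
  match E with
  | ELit b p ts => Lit b p ts
  | EBin c E1 E2 => Bin c (Sh E1) (Sh E2)
  | EEx A _ => Ex A
  | EAll A _ _ => All A
  end.

Fixpoint is_etree (E : etree) : bool :=
  match E with
  | ELit _ _ _ => true
  | EBin _ E1 E2 => is_etree E1 && is_etree E2
  | EEx A l => uniq (map fst l)
      && all (fun q => (Sh q.2 == inst A q.1) && is_etree q.2) l
  | EAll A y E0 => (Sh E0 == inst A (FVar 0 y)) && is_etree E0
  end.

(* Deep formulas are propositional formulas over the first-order atoms; [PBot]
   is the empty disjunction. *)
Inductive pform :=
  | PLit of bool & Ps & seq (term 0)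
  | PBin of conn & pform & pform
  | PBot.

Fixpoint Dp (E : etree) : pform :=
  match E with
  | ELit b p ts => PLit b p ts
  | EBin c E1 E2 => PBin c (Dp E1) (Dp E2)
  | EEx _ l => foldr (PBin Disj) PBot (map (fun q => Dp q.2) l)
  | EAll _ _ E0 => Dp E0
  end.

Fixpoint eval (v : Ps -> seq (term 0) -> bool) (D : pform) : bool :=
  match D with
  | PLit b p ts => v p ts == b
  | PBin Conj D1 D2 => eval v D1 && eval v D2
  | PBin Disj D1 D2 => eval v D1 || eval v D2
  | PBot => false
  end.

Definition tautology (S : seq pform) : Prop := forall v, has (eval v) S.

Definition cut := (etree * etree)%type.

Definition cut_formula (C : cut) : formula 0 := Sh C.1.

Definition is_cut (C : cut) : bool :=
  [&& is_etree C.1, is_etree C.2, Sh C.1 == dual (Sh C.2) & positive (Sh C.1)].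

Record preproof := Preproof { cuts : seq cut; trees : seq etree }.

Definition Sh_pre (P : preproof) : sequent := [fset A in map Sh (trees P)].

Definition Dp_pre (P : preproof) : seq pform :=
  map Dp (trees P) ++ [seq PBin Conj (Dp C.1) (Dp C.2) | C <- cuts P].

Fixpoint eigen (E : etree) : seq nat :=
  match E with
  | ELit _ _ _ => [::]
  | EBin _ E1 E2 => eigen E1 ++ eigen E2
  | EEx _ l => flatten (map (fun q => eigen q.2) l)
  | EAll _ y E0 => y :: eigen E0
  end.

Definition eigen_pre (P : preproof) : seq nat :=
  flatten (map eigen (trees P))
  ++ flatten [seq eigen C.1 ++ eigen C.2 | C <- cuts P].

Definition is_preproof (P : preproof) : Prop :=
  [/\ all is_etree (trees P), all is_cut (cuts P),
      uniq (map cut_formula (cuts P)), uniq (map Sh (trees P))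
    & uniq (eigen_pre P) /\ closed_sequent (Sh_pre P)].

(* Expansions and cuts of a pre-proof are identified by their address. It
   starts with [STree A] for the tree with shallow formula A or with [SCut A]
   for the cut with cut-formula A; the cut itself is [:: SCut A], and the
   address of an expansion ends with the expansion itself, [SEx t] or [SAll y].
   [SLeft] and [SRight] lead to the components of a binary connective or of a
   cut. Addresses are unique in a pre-proof as root formulas are pairwise
   distinct and the instances of an existential node are indexed by a set of
   terms. *)
Inductive step :=
  | SLeft | SRight
  | SEx of term 0 | SAll of nat
  | STree of formula 0 | SCut of formula 0.

Definition enc_step (s : step) :
    bool + (term 0 + (nat + (formula 0 + formula 0))) :=
  match s with
  | SLeft => inl true
  | SRight => inl false
  | SEx t => inr (inl t)
  | SAll y => inr (inr (inl y))
  | STree A => inr (inr (inr (inl A)))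
  | SCut A => inr (inr (inr (inr A)))
  end.

Definition dec_step (x : bool + (term 0 + (nat + (formula 0 + formula 0)))) :=
  match x with
  | inl b => if b then SLeft else SRight
  | inr (inl t) => SEx t
  | inr (inr (inl y)) => SAll y
  | inr (inr (inr (inl A))) => STree A
  | inr (inr (inr (inr A))) => SCut A
  end.

Lemma enc_stepK : cancel enc_step dec_step. Proof. by case. Qed.

HB.instance Definition _ := Choice.copy step (can_type enc_stepK).

Definition node := seq step.

Fixpoint expansions (E : etree) : seq node :=
  match E with
  | ELit _ _ _ => [::]
  | EBin _ E1 E2 =>
      map (cons SLeft) (expansions E1) ++ map (cons SRight) (expansions E2)
  | EEx _ l => flatten
      (map (fun q => [:: SEx q.1] :: map (cons (SEx q.1)) (expansions q.2)) l)
  | EAll _ y E0 => [:: SAll y] :: map (cons (SAll y)) (expansions E0)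
  end.

Definition nodes (P : preproof) : seq node :=
  flatten [seq map (cons (STree (Sh E))) (expansions E) | E <- trees P]
  ++ flatten [seq [:: SCut (cut_formula C)]
                  :: map (cons (SCut (cut_formula C)))
                         (map (cons SLeft) (expansions C.1)
                          ++ map (cons SRight) (expansions C.2)) | C <- cuts P].

Inductive dep0 (P : preproof) : node -> node -> Prop :=
  | dep_term v y w t :
      rcons v (SAll y) \in nodes P -> rcons w (SEx t) \in nodes P ->
      y \in fv_term t -> dep0 P (rcons v (SAll y)) (rcons w (SEx t))
  | dep_dominates v w :
      v \in nodes P -> w \in nodes P -> prefix v w -> v != w -> dep0 P v w
  | dep_in_cut A w :
      [:: SCut A] \in nodes P -> SCut A :: w \in nodes P -> w != [::] ->
      dep0 P [:: SCut A] (SCut A :: w)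
  | dep_cut_formula v y A :
      rcons v (SAll y) \in nodes P -> [:: SCut A] \in nodes P ->
      y \in fv A -> dep0 P (rcons v (SAll y)) [:: SCut A].

Definition dep (P : preproof) : node -> node -> Prop := clos_trans node (dep0 P).

Definition acyclic (P : preproof) : Prop := forall v, ~ dep P v v.

Definition is_expansion_proof (P : preproof) : Prop :=
  [/\ is_preproof P, acyclic P & tautology (Dp_pre P)].

Definition cut_free (P : preproof) : Prop := cuts P = [::].

(* Merging. [merge_tree E1 E2] superposes two trees with the same shallow formula
   and [mgr E1 E2] is the renaming of the eigenvariables of E2 to those of E1
   that it requires; [normalize] applies this renaming to the whole pre-proof.
   Since a renaming can make instance terms or cut-formulas anywhere in the
   pre-proof equal, [normalize] goes on merging trees with equal shallow
   formulas, cuts with equal cut-formulas and instances (of one existential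
   node) with equal terms until there are none left, so that [merge_tree]
   simply concatenates the instances of two existential nodes. *)
Fixpoint merge_tree (E1 E2 : etree) : etree :=
  match E1, E2 with
  | EBin c A1 B1, EBin _ A2 B2 => EBin c (merge_tree A1 A2) (merge_tree B1 B2)
  | EEx A l1, EEx _ l2 => EEx A (l1 ++ l2)
  | EAll A y E, EAll _ _ E' => EAll A y (merge_tree E E')
  | _, _ => E1
  end.

Fixpoint mgr (E1 E2 : etree) : nat -> nat :=
  match E1, E2 with
  | EBin _ A1 B1, EBin _ A2 B2 => mgr A1 A2 \o mgr B1 B2
  | EAll _ y E, EAll _ z E' => mgr E E' \o [eta id with z |-> y]
  | _, _ => id
  end.

Fixpoint ren_tree (r : nat -> nat) (E : etree) : etree :=
  match E with
  | ELit b p ts => ELit b p (map (ren_term r) ts)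
  | EBin c E1 E2 => EBin c (ren_tree r E1) (ren_tree r E2)
  | EEx A l =>
      EEx (ren r A) (map (fun q => (ren_term r q.1, ren_tree r q.2)) l)
  | EAll A y E0 => EAll (ren r A) (r y) (ren_tree r E0)
  end.

Definition ren_pre (r : nat -> nat) (P : preproof) : preproof :=
  Preproof [seq (ren_tree r C.1, ren_tree r C.2) | C <- cuts P]
           [seq ren_tree r E | E <- trees P].

(* Joins the first two elements of a list that have the same key. *)
Fixpoint join_first (T : Type) (K : eqType) (key : T -> K)
    (join : T -> T -> T) (r : T -> T -> nat -> nat) (s : seq T) :
    option (seq T * (nat -> nat)) :=
  if s is x :: s' then
    let i := find (fun y => key y == key x) s' in
    if drop i s' is y :: s2 then Some (join x y :: take i s' ++ s2, r x y)
    else omap (fun u => (x :: u.1, u.2)) (join_first key join r s')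
  else None.

(* Rewrites the first element of a list on which f succeeds. *)
Definition map_first (T R : Type) (f : T -> option (T * R)) :
    seq T -> option (seq T * R) :=
  fix go s :=
    if s is x :: s' then
      if f x is Some (x', r) then Some (x' :: s', r)
      else omap (fun u => (x :: u.1, u.2)) (go s')
    else None.

Fixpoint merge1_tree (E : etree) : option (etree * (nat -> nat)) :=
  match E with
  | ELit _ _ _ => None
  | EBin c E1 E2 =>
      if merge1_tree E1 is Some (E1', r) then Some (EBin c E1' E2, r)
      else omap (fun u => (EBin c E1 u.1, u.2)) (merge1_tree E2)
  | EEx A l =>
      if join_first fst (fun q q' => (q.1, merge_tree q.2 q'.2))
                    (fun q q' => mgr q.2 q'.2) l is Some (l', r)
      then Some (EEx A l', r)
      else omap (fun u => (EEx A u.1, u.2))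
             (map_first (fun q => omap (fun u => ((q.1, u.1), u.2))
                                       (merge1_tree q.2)) l)
  | EAll A y E0 => omap (fun u => (EAll A y u.1, u.2)) (merge1_tree E0)
  end.

Definition merge1_cut (C : cut) : option (cut * (nat -> nat)) :=
  if merge1_tree C.1 is Some (E, r) then Some ((E, C.2), r)
  else omap (fun u => ((C.1, u.1), u.2)) (merge1_tree C.2).

Definition merge1 (P : preproof) : preproof :=
  if join_first Sh merge_tree mgr (trees P) is Some (s, r)
  then ren_pre r (Preproof (cuts P) s)
  else if join_first cut_formula
            (fun C D => (merge_tree C.1 D.1, merge_tree C.2 D.2))
            (fun C D => mgr C.1 D.1 \o mgr C.2 D.2) (cuts P) is Some (s, r)
  then ren_pre r (Preproof s (trees P))
  else if map_first merge1_tree (trees P) is Some (s, r)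
  then ren_pre r (Preproof (cuts P) s)
  else if map_first merge1_cut (cuts P) is Some (s, r)
  then ren_pre r (Preproof s (trees P))
  else P.

Fixpoint tree_size (E : etree) : nat :=
  match E with
  | ELit _ _ _ => 1
  | EBin _ E1 E2 => (tree_size E1 + tree_size E2)%N.+1
  | EEx _ l => (sumn (map (fun q => tree_size q.2) l)).+1
  | EAll _ _ E0 => (tree_size E0).+1
  end.

Definition pre_size (P : preproof) : nat :=
  (sumn (map tree_size (trees P))
  + sumn [seq (tree_size C.1 + tree_size C.2)%N | C <- cuts P])%N.

(* [merge1] decreases [pre_size] unless there is nothing to merge, so this
   number of iterations reaches the fixed point. *)
Definition normalize (P : preproof) : preproof := iter (pre_size P) merge1 P.

Definition cat_pre (P Q : preproof) : preproof :=
  Preproof (cuts P ++ cuts Q) (trees P ++ trees Q).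

Definition one_tree (E : etree) : preproof := Preproof [::] [:: E].
Definition one_cut (E1 E2 : etree) : preproof := Preproof [:: (E1, E2)] [::].

(* Sequents being sets, A |` G may or may not have A in G, in premises as well
   as in conclusions. *)
Inductive LK : sequent -> Type :=
  | LKinit G p ts : LK (Lit true p ts |` (Lit false p ts |` G))
  | LKall G A a : a \notin fv_seq (All A |` G) ->
      LK (inst A (FVar 0 a) |` G) -> LK (All A |` G)
  | LKex G A t : LK (inst A t |` (Ex A |` G)) -> LK (Ex A |` G)
  | LKand G A B : LK (A |` G) -> LK (B |` G) -> LK (Bin Conj A B |` G)
  | LKor G A B : LK (A |` (B |` G)) -> LK (Bin Disj A B |` G)
  | LKcut G A : LK (A |` G) -> LK (dual A |` G) -> LK G.

Fixpoint lk_cut_free G (pi : LK G) : bool :=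
  match pi with
  | LKinit _ _ _ => true
  | LKall _ _ _ _ pi0 => lk_cut_free pi0
  | LKex _ _ _ pi0 => lk_cut_free pi0
  | LKand _ _ _ pi1 pi2 => lk_cut_free pi1 && lk_cut_free pi2
  | LKor _ _ _ pi0 => lk_cut_free pi0
  | LKcut _ _ _ _ => false
  end.

Fixpoint lk_eigen G (pi : LK G) : seq nat :=
  match pi with
  | LKinit _ _ _ => [::]
  | LKall _ _ a _ pi0 => a :: lk_eigen pi0
  | LKex _ _ _ pi0 => lk_eigen pi0
  | LKand _ _ _ pi1 pi2 => lk_eigen pi1 ++ lk_eigen pi2
  | LKor _ _ _ pi0 => lk_eigen pi0
  | LKcut _ _ pi1 pi2 => lk_eigen pi1 ++ lk_eigen pi2
  end.

Fixpoint lk_vars G (pi : LK G) : seq nat :=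
  fv_seq G ++
  match pi with
  | LKinit _ _ _ => [::]
  | LKall _ _ a _ pi0 => a :: lk_vars pi0
  | LKex _ _ t pi0 => fv_term t ++ lk_vars pi0
  | LKand _ _ _ pi1 pi2 => lk_vars pi1 ++ lk_vars pi2
  | LKor _ _ _ pi0 => lk_vars pi0
  | LKcut _ _ pi1 pi2 => lk_vars pi1 ++ lk_vars pi2
  end.

(* x occurs in pi, in a sequent or in the term of an existential inference,
   other than above a universal inference with eigenvariable x. *)
Fixpoint occurs_outside x G (pi : LK G) : bool :=
  (x \in fv_seq G) ||
  match pi with
  | LKinit _ _ _ => false
  | LKall _ _ a _ pi0 => (x != a) && occurs_outside x pi0
  | LKex _ _ t pi0 => (x \in fv_term t) || occurs_outside x pi0
  | LKand _ _ _ pi1 pi2 => occurs_outside x pi1 || occurs_outside x pi2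
  | LKor _ _ _ pi0 => occurs_outside x pi0
  | LKcut _ _ pi1 pi2 => occurs_outside x pi1 || occurs_outside x pi2
  end.

(* Regularity in the standard sense: the eigenvariables of distinct universal
   inferences are distinct and each of them occurs only above its inference.
   Without the second condition the acyclicity of the expansion proof fails. *)
Definition regular G (pi : LK G) : bool :=
  uniq (lk_eigen pi) && all (fun a => ~~ occurs_outside a pi) (lk_eigen pi).

(* The coercion of A, where s instantiates the variables bound outside A:
   existential formulas get no instance and universal formulas a fresh
   eigenvariable. Here and below k is the first variable that is still unused
   and the last component of the result is its new value. *)
Fixpoint coerce_rec m (A : formula m) (s : 'I_m -> term 0) (k : nat) :
    etree * nat :=
  match A with
  | Lit b p ts => (ELit b p (map (subst_term s) ts), k)
  | Bin c A B =>
      let: (E1, k1) := coerce_rec A s k in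
      let: (E2, k2) := coerce_rec B s k1 in
      (EBin c E1 E2, k2)
  | Ex A => (EEx (subst (up s) A) [::], k)
  | All A =>
      let: (E0, k0) := coerce_rec A (scons (FVar 0 k) s) k.+1 in
      (EAll (subst (up s) A) k E0, k0)
  end.

Definition coerce (A : formula 0) (k : nat) : etree * nat :=
  coerce_rec A (@BVar 0) k.

Fixpoint coerce_seq (S : seq (formula 0)) (k : nat) : seq etree * nat :=
  if S is A :: S' then
    let: (E, k1) := coerce A k in
    let: (Es, k2) := coerce_seq S' k1 in
    (E :: Es, k2)
  else ([::], k).

(* For P with shallow sequent A |` G, returns the tree for A and the remaining
   pre-proof with shallow sequent G. If A is in G, then there is only one tree
   for two uses of A; the occurrence of A in the context G is then treated as
   introduced by weakening, that is by coercion as in initial sequents.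
   The default value of [head] is not used. *)
Definition extract (A : formula 0) (G : sequent) (P : preproof) (k : nat) :
    etree * preproof * nat :=
  let: (D, k') := coerce A k in
  (head D [seq E <- trees P | Sh E == A],
   Preproof (cuts P) ([seq E <- trees P | Sh E != A]
                      ++ (if A \in G then [:: D] else [::])),
   k').

(* The whole conclusion is normalized at once because merging the contexts of
   two premises must also rename eigenvariables in the active trees. *)
Fixpoint Exp_rec G (pi : LK G) (k : nat) : preproof * nat :=
  match pi with
  | LKinit G p ts =>
      let: (Es, k') :=
        coerce_seq (Lit true p ts |` (Lit false p ts |` G)) k in
      (Preproof [::] Es, k')
  | LKall G A a _ pi0 =>
      let: (P, k0) := Exp_rec pi0 k in
      let: (E, P', k') := extract (inst A (FVar 0 a)) G P k0 in
      (normalize (cat_pre P' (one_tree (EAll A a E))), k')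
  | LKex G A t pi0 =>
      let: (P, k0) := Exp_rec pi0 k in
      let: (E, P', k') := extract (inst A t) (Ex A |` G) P k0 in
      (normalize (cat_pre P' (one_tree (EEx A [:: (t, E)]))), k')
  | LKand G A B pi1 pi2 =>
      let: (P1, k1) := Exp_rec pi1 k in
      let: (P2, k2) := Exp_rec pi2 k1 in
      let: (E1, P1', k3) := extract A G P1 k2 in
      let: (E2, P2', k4) := extract B G P2 k3 in
      (normalize (cat_pre (cat_pre P1' P2') (one_tree (EBin Conj E1 E2))), k4)
  | LKor G A B pi0 =>
      let: (P, k0) := Exp_rec pi0 k in
      let: (E1, P1, k1) := extract A (B |` G) P k0 in
      let: (E2, P2, k2) := extract B G P1 k1 in
      (normalize (cat_pre P2 (one_tree (EBin Disj E1 E2))), k2)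
  | LKcut G A pi1 pi2 =>
      let: (P1, k1) := Exp_rec pi1 k in
      let: (P2, k2) := Exp_rec pi2 k1 in
      let: (E1, P1', k3) := extract A G P1 k2 in
      let: (E2, P2', k4) := extract (dual A) G P2 k3 in
      (normalize (if positive A
                  then cat_pre (one_cut E1 E2) (cat_pre P1' P2')
                  else cat_pre (one_cut E2 E1) (cat_pre P2' P1')), k4)
  end.

Definition Exp G (pi : LK G) : preproof :=
  (Exp_rec pi (\max_(x <- lk_vars pi) x).+1).1.

End Syntax.

(* Main.v *)
(* By induction on the LK-proof, Exp(pi) is an expansion proof all of whose
   eigenvariables are eigenvariables of pi or were created by coercions. All
   properties but acyclicity are directly preserved by the inferences and by
   merging. For acyclicity, assign to each eigenvariable y a rank with
     rank y = 1 + max {rank x : x occurs above y},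
   where the variables above y are those of the instance terms and the
   eigenvariables on the path to y, and those of the cut-formula if y is in a cut.
   A ranking excludes cycles. Conversely, it exists if the dependencies between
   eigenvariables are well-founded, which regularity guarantees for the
   conclusion of each inference before merging: a new universal expansion
   depends on nothing, and the terms of a new existential expansion and the
   formula of a new cut contain no eigenvariable of the premises.
   Two eigenvariables that merging identifies have the same variables above them
   up to earlier identifications, hence the same rank: any sequence of merges
   preserves the ranking. *)

Require Import Defs.
From mathcomp Require Import all_boot finmap zify.

Set Implicit Arguments.
Unset Strict Implicit.
Unset Printing Implicit Defensive.

Local Open Scope fset_scope.

(** Identifying elements of an acyclic relation may create cycles, so acyclicity alone is too weak
    an invariant for merging. A ranking by inequalities would not do either, since it may give
    matched eigenvariables different ranks. The equations force equal ranks, and one ranking [rho]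
    then serves for a whole normalization, because every renaming [r] applied in it satisfies
    [rho \o r =1 rho]. Solutions of the equations are not stable under inferences, however: a new
    instance term or cut-formula enlarges contexts. Hence only inequalities between eigenvariables
    ([wranked]) are carried from one inference to the next, and [wranked_exact] yields a new exact
    ranking before each normalization. Each merge step is analysed before its renaming is applied.
    The pairs of identified eigenvariables determine this renaming, and as the eigenvariables of a
    pre-proof are distinct, no kept one is also lost. *)

Section ExpansionProofs.
Variables Fs Ps : choiceType.
Notation term := (term Fs).
Notation formula := (formula Fs Ps).
Notation etree := (etree Fs Ps).
Notation preproof := (preproof Fs Ps).

(** * Substitution and renaming *)

Lemma eq_subst_term m n (s1 s2 : 'I_m -> term n) :
  s1 =1 s2 -> subst_term s1 =1 subst_term s2.
Proof.
move=> e; elim/term_nested_ind => [i|x|f ts IH] //=.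
by congr Fn; elim: ts IH => //= t ts IHts [-> /IHts ->].
Qed.

Lemma eq_up m n (s1 s2 : 'I_m -> term n) : s1 =1 s2 -> up s1 =1 up s2.
Proof. by move=> e i; rewrite /up /scons; case: unlift => //= j; rewrite e. Qed.

Lemma eq_subst m n (s1 s2 : 'I_m -> term n) (A : formula m) :
  s1 =1 s2 -> subst s1 A = subst s2 A.
Proof.
elim: A n s1 s2 => {}m => [b p ts|c A IHA B IHB|A IHA|A IHA] n s1 s2 e /=.
- by congr Lit; apply: eq_map; apply: eq_subst_term.
- by rewrite (IHA _ _ _ e) (IHB _ _ _ e).
- by rewrite (IHA _ _ _ (eq_up e)).
- by rewrite (IHA _ _ _ (eq_up e)).
Qed.

Lemma subst_term_comp m n p (s2 : 'I_n -> term p) (s1 : 'I_m -> term n) t :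
  subst_term s2 (subst_term s1 t) = subst_term (subst_term s2 \o s1) t.
Proof.
elim/term_nested_ind: t => [i|x|f ts IH] //=.
by congr Fn; elim: ts IH => //= t ts IHts [-> /IHts ->].
Qed.

Lemma up_comp m n p (s2 : 'I_n -> term p) (s1 : 'I_m -> term n) :
  subst_term (up s2) \o up s1 =1 up (subst_term s2 \o s1).
Proof.
move=> i; rewrite /= /up /scons; case: unliftP => [j|] _ /=; last first.
  by rewrite unlift_none.
rewrite !subst_term_comp; apply: eq_subst_term => k /=.
by rewrite liftK.
Qed.

Lemma subst_comp m n p (s2 : 'I_n -> term p) (s1 : 'I_m -> term n)
    (A : formula m) :
  subst s2 (subst s1 A) = subst (subst_term s2 \o s1) A.
Proof.
elim: A n p s1 s2 => {}m => [b q ts|c A IHA B IHB|A IHA|A IHA] n p s1 s2 /=.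
- by congr Lit; rewrite -map_comp; apply: eq_map => t /=; apply: subst_term_comp.
- by rewrite IHA IHB.
- by rewrite IHA (eq_subst _ (up_comp _ _)).
- by rewrite IHA (eq_subst _ (up_comp _ _)).
Qed.

Lemma subst_term_id n (s : 'I_n -> term n) : s =1 @BVar Fs n -> subst_term s =1 id.
Proof.
move=> e; elim/term_nested_ind => [i|x|f ts IH] //=.
by congr Fn; elim: ts IH => //= t ts IHts [-> /IHts ->].
Qed.

Lemma subst_id n (s : 'I_n -> term n) (A : formula n) :
  s =1 @BVar Fs n -> subst s A = A.
Proof.
have up_id m (s0 : 'I_m -> term m) : s0 =1 @BVar Fs m -> up s0 =1 @BVar Fs m.+1.
  by move=> e i; rewrite /up /scons; case: unliftP => [j ->|->] //; rewrite e.
elim: A s => {}n => [b q ts|c A IHA B IHB|A IHA|A IHA] s e /=.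
- by rewrite (eq_map (subst_term_id e)) map_id.
- by rewrite IHA ?IHB.
- by rewrite IHA //; apply: up_id.
- by rewrite IHA //; apply: up_id.
Qed.

Lemma inst_subst_up m (A : formula m.+1) (s : 'I_m -> term 0) t :
  inst (subst (up s) A) t = subst (scons t s) A.
Proof.
rewrite /inst subst_comp; apply: eq_subst => i /=.
rewrite /up /scons; case: unlift => [j|] //=.
by rewrite subst_term_comp; apply: subst_term_id => -[].
Qed.

Lemma ren_subst_term m n r (s : 'I_m -> term n) t :
  ren_term r (subst_term s t) = subst_term (ren_term r \o s) (ren_term r t).
Proof.
elim/term_nested_ind: t => [i|x|f ts IH] //=.
by congr Fn; elim: ts IH => //= t ts IHts [-> /IHts ->].
Qed.

Lemma ren_subst m n r (s : 'I_m -> term n) (A : formula m) :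
  ren r (subst s A) = subst (ren_term r \o s) (ren r A).
Proof.
have ren_up m' n' (s' : 'I_m' -> term n') :
    ren_term r \o up s' =1 up (ren_term r \o s').
  move=> i; rewrite /= /up /scons; case: unlift => //= j.
  by rewrite ren_subst_term; apply: eq_subst_term.
elim: A n s => {}m => [b q ts|c A IHA B IHB|A IHA|A IHA] n s /=.
- by congr Lit; rewrite -!map_comp; apply: eq_map => t /=; apply: ren_subst_term.
- by rewrite IHA IHB.
- by rewrite IHA (eq_subst _ (ren_up _ _ _)).
- by rewrite IHA (eq_subst _ (ren_up _ _ _)).
Qed.

Lemma ren_inst r (A : formula 1) t :
  ren r (inst A t) = inst (ren r A) (ren_term r t).
Proof. by rewrite /inst ren_subst; apply: eq_subst. Qed.

Lemma fv_ren_term n r (t : term n) : fv_term (ren_term r t) = map r (fv_term t).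
Proof.
elim/term_nested_ind: t => [i|x|f ts IH] //=.
by elim: ts IH => //= t ts IHts [-> /IHts ->]; rewrite map_cat.
Qed.

Lemma fv_ren n r (A : formula n) : fv (ren r A) = map r (fv A).
Proof.
elim: A => {}n => [b q ts|c A IHA B IHB|A IHA|A IHA] //=.
- by elim: ts => //= t ts ->; rewrite fv_ren_term map_cat.
- by rewrite IHA IHB map_cat.
Qed.

Lemma ren_term_id n r (t : term n) : {in fv_term t, r =1 id} -> ren_term r t = t.
Proof.
elim/term_nested_ind: t => [i|x|f ts IH] //= e.
  by rewrite e // mem_head.
congr Fn; elim: ts IH e => //= t ts IHts [IHt IH] e.
by rewrite IHt ?IHts // => x xt; apply: e; rewrite mem_cat xt ?orbT.
Qed.

Lemma ren_id n r (A : formula n) : {in fv A, r =1 id} -> ren r A = A.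
Proof.
elim: A => {}n => [b q ts|c A IHA B IHB|A IHA|A IHA] //= e.
- congr Lit; elim: ts e => //= t ts IH e.
  by rewrite ren_term_id ?IH // => x xt; apply: e; rewrite mem_cat xt ?orbT.
- by rewrite IHA ?IHB // => x xA; apply: e; rewrite mem_cat xA ?orbT.
- by rewrite IHA.
- by rewrite IHA.
Qed.

Lemma ren_dual n r (A : formula n) : ren r (dual A) = dual (ren r A).
Proof. by elim: A => {}n => [b p ts|[] A IHA B IHB|A IHA|A IHA] //=;
  rewrite ?IHA ?IHB. Qed.

Lemma dualK n : involutive (@dual Fs Ps n).
Proof.
elim=> {}n => [b p ts|[] A IHA B IHB|A IHA|A IHA] /=; rewrite ?negbK //.
all: by rewrite ?IHA ?IHB.
Qed.

Lemma positive_ren n r (A : formula n) : positive (ren r A) = positive A.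
Proof. by case: A. Qed.

Lemma positive_dual n (A : formula n) : positive (dual A) = ~~ positive A.
Proof. by case: A => // -[]. Qed.

Lemma fv_dual n (A : formula n) : fv (dual A) = fv A.
Proof. by elim: A => {}n => [b p ts|[] A IHA B IHB|A IHA|A IHA] //=;
  rewrite ?IHA ?IHB. Qed.

Lemma fv_seqP (G : sequent Fs Ps) x :
  reflect (exists2 A, A \in G & x \in fv A) (x \in fv_seq G).
Proof. exact: flatten_mapP. Qed.

Lemma fv_seq_fset1U (A : formula 0) (G : sequent Fs Ps) x :
  (x \in fv_seq (A |` G)) = (x \in fv A) || (x \in fv_seq G).
Proof.
apply/fv_seqP/orP => [[B]|[xA|/fv_seqP[B BG xB]]].
- by rewrite !inE => /orP[/eqP-> ?|BG xB]; [left|right; apply/fv_seqP; exists B].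
- by exists A; rewrite // !inE eqxx.
- by exists B; rewrite // !inE BG orbT.
Qed.

Fixpoint etree_nested_ind (T : etree -> Prop)
    (Hlit : forall b p ts, T (ELit b p ts))
    (Hbin : forall c E1, T E1 -> forall E2, T E2 -> T (EBin c E1 E2))
    (Hex : forall A l, foldr (fun q Q => T q.2 /\ Q) True l -> T (EEx A l))
    (Hall : forall A y E, T E -> T (EAll A y E)) (E : etree) : T E :=
  match E with
  | ELit b p ts => Hlit b p ts
  | EBin c E1 E2 => Hbin c E1 (etree_nested_ind Hlit Hbin Hex Hall E1)
                      E2 (etree_nested_ind Hlit Hbin Hex Hall E2)
  | EEx A l => Hex A l
      ((fix go s : foldr (fun q Q => T q.2 /\ Q) True s :=
          if s is u :: s' then conj (etree_nested_ind Hlit Hbin Hex Hall u.2) (go s')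
          else I) l)
  | EAll A y E0 => Hall A y E0 (etree_nested_ind Hlit Hbin Hex Hall E0)
  end.

(** * Merging two trees *)

(* Drops from [is_etree] the uniqueness of instance terms, which holds only once
   all merges have been done. *)
Fixpoint wf_tree (E : etree) : bool :=
  match E with
  | ELit _ _ _ => true
  | EBin _ E1 E2 => wf_tree E1 && wf_tree E2
  | EEx A l => all (fun q => (Sh q.2 == inst A q.1) && wf_tree q.2) l
  | EAll A y E0 => (Sh E0 == inst A (FVar Fs 0 y)) && wf_tree E0
  end.

Fixpoint tree_vars (E : etree) : seq nat :=
  match E with
  | ELit _ _ _ => [::]
  | EBin _ E1 E2 => tree_vars E1 ++ tree_vars E2
  | EEx _ l => flatten (map (fun q => fv_term q.1 ++ tree_vars q.2) l)
  | EAll _ y E0 => y :: tree_vars E0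
  end.

Definition rk (rho : nat -> nat) (s : seq nat) : nat := \max_(x <- s) rho x.

(* [c] is the rank of the context, i.e. the greatest rank of a variable above E. *)
Fixpoint ranked (rho : nat -> nat) (c : nat) (E : etree) : bool :=
  match E with
  | ELit _ _ _ => true
  | EBin _ E1 E2 => ranked rho c E1 && ranked rho c E2
  | EEx _ l => all (fun q => ranked rho (maxn (rk rho (fv_term q.1)) c) q.2) l
  | EAll _ y E0 => (rho y == c.+1) && ranked rho c.+1 E0
  end.

Lemma rk_map rho r s : rk rho (map r s) = rk (rho \o r) s.
Proof. by rewrite /rk big_map. Qed.

Lemma eq_rk rho1 rho2 s : {in s, rho1 =1 rho2} -> rk rho1 s = rk rho2 s.
Proof. by move=> e; rewrite /rk; apply: eq_big_seq. Qed.

Lemma leq_rk rho s x : x \in s -> rho x <= rk rho s.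
Proof. by move=> xs; rewrite /rk; apply: leq_bigmax_seq. Qed.

Lemma Sh_ren r (E : etree) : Sh (ren_tree r E) = ren r (Sh E).
Proof. by elim: E => //= c E1 -> E2 ->. Qed.

Lemma wf_ren r (E : etree) : wf_tree E -> wf_tree (ren_tree r E).
Proof.
elim/etree_nested_ind: E => [b p ts|c E1 IH1 E2 IH2|A l IH|A y E IH] //=.
- by move=> /andP[/IH1-> /IH2->].
- elim: l IH => //= -[t E] l IHl [/= IHE /IHl{}IHl] /andP[/andP[/eqP e /IHE->]].
  by move=> /IHl->; rewrite Sh_ren e ren_inst eqxx.
- by move=> /andP[/eqP e /IH->]; rewrite Sh_ren e ren_inst eqxx.
Qed.

Lemma eigen_ren r (E : etree) : eigen (ren_tree r E) = map r (eigen E).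
Proof.
elim/etree_nested_ind: E => [b p ts|c E1 IH1 E2 IH2|A l IH|A y E IH] //=.
- by rewrite IH1 IH2 map_cat.
- by elim: l IH => //= q l IHl [-> /IHl->]; rewrite map_cat.
- by rewrite IH.
Qed.

Lemma tree_vars_ren r (E : etree) : tree_vars (ren_tree r E) = map r (tree_vars E).
Proof.
elim/etree_nested_ind: E => [b p ts|c E1 IH1 E2 IH2|A l IH|A y E IH] //=.
- by rewrite IH1 IH2 map_cat.
- elim: l IH => //= q l IHl [-> /IHl->].
  by rewrite !map_cat fv_ren_term.
- by rewrite IH.
Qed.

Lemma tree_size_ren r (E : etree) : tree_size (ren_tree r E) = tree_size E.
Proof.
elim/etree_nested_ind: E => [b p ts|c E1 IH1 E2 IH2|A l IH|A y E IH] //=.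
- by rewrite IH1 IH2.
- by congr S; elim: l IH => //= q l IHl [-> /IHl->].
- by rewrite IH.
Qed.

(** Only the ranks of variables enter [ranked], never the variables themselves; so the same ranking
    survives all renamings of a normalization. *)
Lemma ranked_ren rho r c (E : etree) :
  rho \o r =1 rho -> ranked rho c (ren_tree r E) = ranked rho c E.
Proof.
move=> e.
elim/etree_nested_ind: E c => [b p ts|d E1 IH1 E2 IH2|A l IH|A y E IH] c //=.
- by rewrite IH1 IH2.
- elim: l IH => //= q l IHl [-> /IHl->].
  by rewrite fv_ren_term rk_map (eq_rk (rho2 := rho)).
- by rewrite IH [rho (r y)]e.
Qed.

Lemma eval_Dp_ex v A l :
  eval v (Dp (EEx A l : etree)) = has (fun q => eval v (Dp q.2)) l.
Proof. by elim: l => //= q l ->. Qed.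

Lemma eval_Dp_ren v r (E : etree) :
  eval v (Dp (ren_tree r E)) = eval (fun p ts => v p (map (ren_term r) ts)) (Dp E).
Proof.
elim/etree_nested_ind: E => [b p ts|[] E1 IH1 E2 IH2|A l IH|A y E IH] //=.
- by rewrite IH1 IH2.
- by rewrite IH1 IH2.
- by elim: l IH => //= q l IHl [-> /IHl->].
Qed.

Lemma flatten_map_cat (T S : Type) (f : T -> seq S) s1 s2 :
  flatten (map f (s1 ++ s2)) = flatten (map f s1) ++ flatten (map f s2).
Proof. by rewrite map_cat flatten_cat. Qed.

Lemma flatten_map_cons (T S : Type) (f : T -> seq S) x s :
  flatten (map f (x :: s)) = f x ++ flatten (map f s).
Proof. by []. Qed.

Definition unifies (f : nat -> nat) (m : seq (nat * nat)) : Prop :=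
  forall y z, (y, z) \in m -> f y = f z.

(** The head of the list is applied first, so a variable that has just replaced another is subject
    to the remaining pairs. *)
Definition repl (m : seq (nat * nat)) : nat -> nat :=
  foldr (fun yz f => f \o [eta id with yz.2 |-> yz.1]) id m.

Lemma repl_cat m1 m2 : repl (m1 ++ m2) = repl m2 \o repl m1.
Proof. by elim: m1 => //= -[y z] m1 /= ->. Qed.

Lemma repl_comp rho m : unifies rho m -> rho \o repl m =1 rho.
Proof.
elim: m => //= -[y z] m IH U x /=.
have /IH{}IH : unifies rho m by move=> a b ab; apply: U; rewrite inE ab orbT.
rewrite [rho _]IH; case: (eqVneq x z) => //= ->.
by apply: U; rewrite mem_head.
Qed.

Lemma repl_out m x : x \notin map snd m -> repl m x = x.
Proof.
elim: m => //= -[y z] m IH; rewrite inE negb_or /= => /andP[xz xm].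
by rewrite (negbTE xz) IH.
Qed.

Lemma repl_in m x : repl m x = x \/ repl m x \in map fst m.
Proof.
elim: m x => [|[y z] m IH] x /=; first by left.
rewrite inE; case: (eqVneq x z) => [_|_]; last first.
  by case: (IH x) => [->|->]; [left|right; rewrite orbT].
by right; case: (IH y) => [->|->]; rewrite ?eqxx ?orbT.
Qed.

(** Kept variables are never lost and lost ones are pairwise distinct, so no replacement interferes
    with another: both components of a pair end at the kept one. *)
Lemma repl_unifies m :
  uniq (map snd m) -> {in map fst m, forall x, x \notin map snd m} ->
  unifies (repl m) m.
Proof.
elim: m => //= -[a b] m IH /andP[bm um] D y z; rewrite inE => /orP[/eqP[-> ->]|yzm] /=.
  by rewrite eqxx; case: ifP.
have yF : y \notin b :: map snd m.
  by apply: D; rewrite inE (map_f fst yzm) orbT.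
have zm : z \in map snd m by apply: (map_f snd yzm).
move: yF; rewrite inE negb_or => /andP[yb ym].
have zb : z != b by apply: contraNneq bm => <-.
rewrite (negbTE yb) (negbTE zb); apply: IH => // x xm.
have := D x; rewrite /= !inE xm orbT negb_or => /(_ isT) /andP[] //.
Qed.

(** The pairs of the right components come first because [mgr] applies their renaming first. *)
Fixpoint matched (E1 E2 : etree) : seq (nat * nat) :=
  match E1, E2 with
  | EBin _ A1 B1, EBin _ A2 B2 => matched B1 B2 ++ matched A1 A2
  | EAll _ y E, EAll _ z E' => (y, z) :: matched E E'
  | _, _ => [::]
  end.

Lemma mgr_repl (E1 E2 : etree) : mgr E1 E2 = repl (matched E1 E2).
Proof.
elim: E1 E2 => [b p ts|c A1 IHA B1 IHB|A l|A y E IH]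
  [b' p' ts'|c' A2 B2|A' l'|A' z E'] //=.
- by rewrite repl_cat IHA IHB.
- by rewrite IH.
Qed.

Lemma Sh_merge (E1 E2 : etree) : Sh (merge_tree E1 E2) = Sh E1.
Proof.
elim: E1 E2 => [b p ts|c A1 IHA B1 IHB|A l|A y E IH]
  [b' p' ts'|c' A2 B2|A' l'|A' z E'] //=.
by rewrite IHA IHB.
Qed.

Lemma merge_size (E1 E2 : etree) :
  tree_size (merge_tree E1 E2) < tree_size E1 + tree_size E2.
Proof.
elim: E1 E2 => [b p ts|c A1 IHA B1 IHB|A l|A y E IH]
  [b' p' ts'|c' A2 B2|A' l'|A' z E'] //=;
  try lia.
- by have := IHA A2; have := IHB B2; lia.
- by rewrite map_cat sumn_cat; lia.
- by have := IH E'; lia.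
Qed.

Lemma tree_vars_merge (E1 E2 : etree) :
  {subset tree_vars (merge_tree E1 E2) <= tree_vars E1 ++ tree_vars E2}.
Proof.
elim: E1 E2 => [b p ts|c A1 IHA B1 IHB|A l|A y E IH]
  [b' p' ts'|c' A2 B2|A' l'|A' z E'] //= x;
  rewrite ?cats0 // -?cat_cons; try by move=> h; rewrite mem_cat h.
- rewrite !mem_cat => /orP[/IHA|/IHB]; rewrite mem_cat => /orP[] ->; rewrite ?orbT //.
- by rewrite map_cat flatten_cat.
- rewrite mem_cat !inE => /orP[->//|/IH].
  by rewrite mem_cat => /orP[] ->; rewrite ?orbT.
Qed.

Lemma matched_merge (E1 E2 : etree) :
  {subset map fst (matched E1 E2) <= eigen (merge_tree E1 E2)}.
Proof.
elim: E1 E2 => [b p ts|c A1 IHA B1 IHB|A l|A y E IH]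
  [b' p' ts'|c' A2 B2|A' l'|A' z E'] //= x.
- by rewrite map_cat !mem_cat => /orP[/IHB|/IHA] ->; rewrite ?orbT.
- by rewrite !inE => /orP[->|/IH ->]; rewrite ?orbT.
Qed.

(** The two trees are descended in parallel from the same context rank [c]. At universal nodes the
    rank equation determines the rank of the eigenvariable from [c] alone, so matched eigenvariables
    have equal ranks and their subtrees again have equal context ranks. *)
Lemma ranked_merge rho c (E1 E2 : etree) :
  ranked rho c E1 -> ranked rho c E2 ->
  unifies rho (matched E1 E2) /\ ranked rho c (merge_tree E1 E2).
Proof.
elim: E1 E2 c => [b p ts|d A1 IHA B1 IHB|A l|A y E IH]
  [b' p' ts'|d' A2 B2|A' l'|A' z E'] c //=.
- move=> /andP[a1 b1] /andP[a2 b2].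
  have [UA ->] := IHA _ _ a1 a2; have [UB ->] := IHB _ _ b1 b2; split=> // u v.
  by rewrite mem_cat => /orP[/UB|/UA].
- by move=> r1 r2; rewrite all_cat r1 r2.
- move=> /andP[/eqP e r1] /andP[/eqP e' r2].
  have [U ->] := IH _ _ r1 r2; rewrite e eqxx; split=> // u v.
  by rewrite inE => /orP[/eqP[-> ->]|/U]; rewrite ?e ?e'.
Qed.

(** The shallow formulas are compared only after renaming: below matched universal nodes the same
    body is instantiated by two different eigenvariables, which agree only under [r]. *)
Lemma merge_treeP r (E1 E2 : etree) :
  wf_tree E1 -> wf_tree E2 -> unifies r (matched E1 E2) ->
  ren r (Sh E1) = ren r (Sh E2) ->
  [/\ wf_tree (ren_tree r (merge_tree E1 E2)),
      forall v, eval v (Dp (ren_tree r E1)) || eval v (Dp (ren_tree r E2)) ->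
                eval v (Dp (ren_tree r (merge_tree E1 E2)))
    & perm_eq (eigen (merge_tree E1 E2) ++ map snd (matched E1 E2))
              (eigen E1 ++ eigen E2)].
Proof.
elim: E1 E2 => [b p ts|c A1 IHA B1 IHB|A l|A y E IH]
  [b' p' ts'|c' A2 B2|A' l'|A' z E'] //=.
- by move=> _ _ _ [-> -> ->]; split=> // v; rewrite orbb.
- move=> /andP[wA1 wB1] /andP[wA2 wB2] U [<- eA eB].
  have [|wA vA pA] := IHA _ wA1 wA2 _ eA.
    by move=> y z yz; apply: U; rewrite mem_cat yz orbT.
  have [|wB vB pB] := IHB _ wB1 wB2 _ eB.
    by move=> y z yz; apply: U; rewrite mem_cat yz.
  split.
  + by rewrite wA wB.
  + move=> v; have {}vA := vA v; have {}vB := vB v.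
    case: (c) => [/orP[]/andP[a b]|/orP[]/orP[]a].
    1,2: by rewrite vA ?a ?orbT // vB ?b ?orbT.
    1,3: by rewrite vA ?a ?orbT.
    1,2: by rewrite vB ?a ?orbT.
  + apply/permP => a; rewrite map_cat.
    by move/permP/(_ a): pA; move/permP/(_ a): pB; rewrite !count_cat; lia.
- move=> wl wl' _ [e]; split.
  + rewrite map_cat all_cat; apply/andP; split; rewrite all_map.
      apply: sub_all wl => q /= /andP[/eqP eq wq].
      by rewrite Sh_ren eq ren_inst eqxx wf_ren.
    apply: sub_all wl' => q /= /andP[/eqP eq wq].
    by rewrite Sh_ren eq ren_inst e eqxx wf_ren.
  + move=> v; pose D l0 := eval_Dp_ex v A l0; move: D => /= D.
    by rewrite !D map_cat has_cat.
  + by rewrite cats0 map_cat flatten_cat.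
- move=> /andP[/eqP s w] /andP[/eqP s' w'] U [e].
  have [||wE vE pE] := IH _ w w'.
  + by move=> a b ab; apply: U; rewrite inE ab orbT.
  + rewrite s s' !ren_inst e /=; congr (inst _ (FVar _ _ _)).
    by apply: U; rewrite mem_head.
  split=> //.
  + by rewrite wE Sh_ren Sh_merge s ren_inst eqxx.
  + apply/permP => a; move/permP/(_ a): pE.
    by rewrite /= !count_cat /= ?count_cat /=; lia.
Qed.

(** * Single merge steps *)

(* Every property of a merge is stated for the tree in which the matched
   eigenvariables have not been renamed yet; [m] lists the pairs (kept, lost)
   of eigenvariables that a subsequent renaming has to identify. *)
Record reduces (E E' : etree) (m : seq (nat * nat)) : Prop := Reduces {
  reduces_Sh : Sh E' = Sh E;
  reduces_eigen : perm_eq (eigen E' ++ map snd m) (eigen E);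
  reduces_fst : {subset map fst m <= eigen E'};
  reduces_vars : {subset tree_vars E' <= tree_vars E};
  reduces_size : tree_size E' < tree_size E;
  reduces_wf : forall r, unifies r m -> wf_tree (ren_tree r E');
  reduces_eval : forall r v, unifies r m ->
    eval v (Dp (ren_tree r E)) -> eval v (Dp (ren_tree r E'));
  reduces_ranked : forall rho c, ranked rho c E ->
    unifies rho m /\ ranked rho c E' }.

(** * Merge steps in a list of trees with keys *)

Section ListReduction.

Variables (T : Type) (K : eqType) (key : T -> K) (lab : K -> seq nat).
Variables (tr : T -> etree) (size : T -> nat).

Inductive list_reduces : seq T -> seq T -> seq (nat * nat) -> Prop :=
  | ReducesJoin s1 x s2 y s3 z :
      key x = key y -> key z = key x -> Sh (tr x) = Sh (tr y) ->
      tr z = merge_tree (tr x) (tr y) -> size z < size x + size y ->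
      list_reduces (s1 ++ x :: s2 ++ y :: s3) (s1 ++ z :: s2 ++ s3)
        (matched (tr x) (tr y))
  | ReducesOne s1 x s2 x' m :
      reduces (tr x) (tr x') m -> key x' = key x -> size x' < size x ->
      list_reduces (s1 ++ x :: s2) (s1 ++ x' :: s2) m.

Variables (s s' : seq T) (m : seq (nat * nat)).
Hypothesis ss' : list_reduces s s' m.
Hypothesis wf_s : all (fun x => wf_tree (tr x)) s.

Let joinP x y r : Sh (tr x) = Sh (tr y) -> wf_tree (tr x) -> wf_tree (tr y) ->
  unifies r (matched (tr x) (tr y)) ->
  [/\ wf_tree (ren_tree r (merge_tree (tr x) (tr y))),
      forall v, eval v (Dp (ren_tree r (tr x))) || eval v (Dp (ren_tree r (tr y))) ->
                eval v (Dp (ren_tree r (merge_tree (tr x) (tr y))))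
    & perm_eq (eigen (merge_tree (tr x) (tr y)) ++ map snd (matched (tr x) (tr y)))
              (eigen (tr x) ++ eigen (tr y))].
Proof. by move=> e wx wy U; apply: merge_treeP => //; rewrite e. Qed.

(** Through this, any condition on keys passes from [s] to [s']. *)
Lemma list_reduces_key : map key s' =i map key s.
Proof.
case: ss' => [s1 x s2 y s3 z kxy kz _ _ _|s1 x s2 x' m' _ kx _] k;
  rewrite !map_cat /= ?map_cat !mem_cat !inE ?mem_cat ?inE.
- by rewrite kz -kxy; case: (k == key x); rewrite ?orbT.
- by rewrite kx.
Qed.

Lemma list_reduces_eigen :
  perm_eq (flatten (map (fun x => eigen (tr x)) s') ++ map snd m)
          (flatten (map (fun x => eigen (tr x)) s)).
Proof.
case: ss' wf_s => [s1 x s2 y s3 z _ _ e ez _|s1 x s2 x' m' red _ _] w.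
  move: w; rewrite all_cat /= all_cat /= => /and4P[_ wx _ /andP[wy _]].
  (* The permutation does not mention the renaming, and a constant one unifies everything. *)
  have [|_ _ /permP p] := joinP (r := fun=> 0) e wx wy; first by [].
  apply/permP => a; have := p a.
  by rewrite !map_cat /= !map_cat /= !flatten_cat /= !flatten_cat /= ez !count_cat; lia.
apply/permP => a; have /permP/(_ a) := reduces_eigen red.
by rewrite !map_cat /= !flatten_cat /= !count_cat; lia.
Qed.

Lemma list_reduces_fst :
  {subset map fst m <= flatten (map (fun x => eigen (tr x)) s')}.
Proof.
move=> y; case: ss' => [s1 x s2 x2 s3 z _ _ e ez _|s1 x s2 x' m' red _ _] ym;
  rewrite map_cat flatten_cat /= !mem_cat.
- by rewrite ez (matched_merge ym) orbT.
- by rewrite (reduces_fst red ym) orbT.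
Qed.

Lemma list_reduces_vars :
  {subset flatten (map (fun x => lab (key x) ++ tree_vars (tr x)) s')
   <= flatten (map (fun x => lab (key x) ++ tree_vars (tr x)) s)}.
Proof.
move=> a; case: ss' => [s1 x s2 y s3 z kxy kz e ez _|s1 x s2 x' m' red kx _];
  rewrite !(flatten_map_cons, flatten_map_cat, mem_cat).
- rewrite kz ez => /or3P[->//|/orP[->|/tree_vars_merge]|/orP[]->]; rewrite ?orbT //.
  by rewrite mem_cat => /orP[] ->; rewrite ?orbT.
- by rewrite kx => /or3P[->//|/orP[->|/(reduces_vars red)->]|->]; rewrite ?orbT.
Qed.

Lemma list_reduces_size : sumn (map size s') < sumn (map size s).
Proof.
clear wf_s; case: ss' => [s1 x s2 y s3 z _ _ _ _ h|s1 x s2 x' m' _ _ h];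
  rewrite !(map_cat, sumn_cat) /= ?(map_cat, sumn_cat) /=; lia.
Qed.

Lemma list_reduces_wf r :
  unifies r m -> all (fun x => wf_tree (ren_tree r (tr x))) s'.
Proof.
have wr s0 : all (fun x => wf_tree (tr x)) s0 ->
    all (fun x => wf_tree (ren_tree r (tr x))) s0.
  by apply: sub_all => x; apply: wf_ren.
case: ss' wf_s => [s1 x s2 y s3 z _ _ e ez _|s1 x s2 x' m' red _ _] w U.
  move: w; rewrite all_cat /= all_cat /= => /and4P[w1 wx w2 /andP[wy w3]].
  by have [wz _ _] := joinP e wx wy U; rewrite all_cat /= all_cat ez wz !wr.
move: w; rewrite !all_cat /= => /and3P[/wr-> _ /wr->].
by rewrite (reduces_wf red U).
Qed.

Lemma list_reduces_eval r v : unifies r m ->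
  has (fun x => eval v (Dp (ren_tree r (tr x)))) s ->
  has (fun x => eval v (Dp (ren_tree r (tr x)))) s'.
Proof.
case: ss' wf_s => [s1 x s2 y s3 z _ _ e ez _|s1 x s2 x' m' red _ _] w U.
  move: w; rewrite all_cat /= all_cat /= => /and4P[_ wx _ /andP[wy _]].
  have [_ /(_ v) h _] := joinP e wx wy U; rewrite !has_cat /= !has_cat /= ez.
  case/or4P=> [->|hx|->|/orP[hy|->]]; rewrite ?orbT //.
    by rewrite h ?hx ?orbT.
  by rewrite h ?hy ?orbT.
rewrite !has_cat /= => /or3P[->//|/(reduces_eval red U)->|->]; rewrite ?orbT //.
Qed.

(** Elements that are joined have equal keys, hence equal context ranks, as [ranked_merge]
    requires. *)
Lemma list_reduces_ranked rho c :
  all (fun x => ranked rho (maxn (rk rho (lab (key x))) c) (tr x)) s ->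
  unifies rho m /\
  all (fun x => ranked rho (maxn (rk rho (lab (key x))) c) (tr x)) s'.
Proof.
case: ss' => [s1 x s2 y s3 z kxy kz _ ez _|s1 x s2 x' m' red kx _].
  rewrite !all_cat /= !all_cat /= => /and4P[-> rx -> /andP[]].
  rewrite kz ez -kxy => ry ->.
  by have [U ->] := ranked_merge rx ry.
rewrite !all_cat /= => /and3P[-> rx ->]; rewrite kx.
by have [U ->] := reduces_ranked red rx.
Qed.

End ListReduction.

Lemma join_firstP (T : Type) (K : eqType) (key : T -> K) join r s :
  if join_first key join r s is Some (s', f) then
    exists s1 x s2 y s3, [/\ s = s1 ++ x :: s2 ++ y :: s3,
      s' = s1 ++ join x y :: s2 ++ s3, key x = key y & f = r x y]
  else uniq (map key s).
Proof.
elim: s => //= x s IH; set i := find _ s.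
(* A failing [find] returns the size of the list, so [drop] is empty exactly when the key of [x]
   does not recur. *)
case E: (drop i s) => [|y s3].
  have xs : key x \notin map key s.
    rewrite -has_pred1 has_map (eq_has (a2 := fun y => key y == key x)) //.
    by rewrite has_find -/i -leqNgt -subn_eq0 -size_drop E.
  case: join_first IH => [[s' f]|]; last by rewrite /= xs.
  move=> [s1 [x1 [s2 [y [s3 [-> -> k ->]]]]]].
  by exists (x :: s1), x1, s2, y, s3.
exists [::], x, (take i s), y, s3; split=> //.
  by rewrite -E cat_take_drop.
have h : has (fun y => key y == key x) s.
  by rewrite has_find -/i ltnNge -subn_eq0 -size_drop E.
have := nth_find x h; rewrite -/i -[in nth _ s i](cat_take_drop i s) E nth_cat.
by rewrite size_take -has_find h ltnn subnn /= => /eqP.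
Qed.

Lemma map_firstP (T R : Type) (f : T -> option (T * R)) s :
  if map_first f s is Some (s', r) then
    exists s1 x s2 x', [/\ s = s1 ++ x :: s2, s' = s1 ++ x' :: s2
      & f x = Some (x', r)]
  else all (fun x => ~~ isSome (f x)) s.
Proof.
elim: s => //= x s IH; case E: (f x) => [[x' r]|] /=.
  by exists [::], x, s, x'.
case: map_first IH => [[s' r] [s1 [y [s2 [y' [-> -> fy]]]]]|] //=.
by exists (x :: s1), y, s2, y'.
Qed.

Lemma all_andb (T : Type) (a b : pred T) s :
  all (fun x => a x && b x) s = all a s && all b s.
Proof. exact: all_predI. Qed.

(* The canonical decidable equality on terms depends on [Ps], which the type of
   terms does not determine; hence the explicit instance. *)
Definition ex_key : eqType :=
  (Defs_term__canonical__eqtype_Equality Fs Ps 0 * formula 0)%type.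

Definition lab_ex (k : ex_key) : seq nat := fv_term k.1.

(** With the shallow formula in the key, the requirement that a tree belong to its instance term is
    a condition on keys. *)
Definition key_ex (q : term 0 * etree) : ex_key := (q.1, Sh q.2).

Lemma list_reduces_ex A l l' m :
  @list_reduces _ ex_key key_ex (fun q : term 0 * etree => q.2)
    (fun q => tree_size q.2) l l' m -> wf_tree (EEx A l) ->
  reduces (EEx A l) (EEx A l') m.
Proof.
move=> red w.
have wl : all (fun q => wf_tree q.2) l by apply: sub_all w => q /andP[].
split=> //.
- exact: list_reduces_eigen red wl.
- exact: list_reduces_fst red.
- by move=> x; apply: (list_reduces_vars (lab := lab_ex) red).
- by rewrite /= ltnS (list_reduces_size red).
- move=> r U; have /= := list_reduces_wf red wl U; rewrite all_map.
  have := w; rewrite /= all_andb => /andP[wk _].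
  have {wk}: all (fun k : ex_key => k.2 == inst A k.1) (map key_ex l').
    by rewrite (eq_all_r (list_reduces_key red)) all_map.
  rewrite all_map => wk wl'; rewrite all_andb wl' andbT.
  by apply: sub_all wk => q /= /eqP e; rewrite Sh_ren e ren_inst.
- move=> r v U; rewrite /= !(eval_Dp_ex _ (ren r A)) !has_map.
  exact: list_reduces_eval red wl _ _ U.
- move=> rho c /= rl.
  exact: (list_reduces_ranked (lab := lab_ex) red rl).
Qed.

Lemma reduces_binl c E1 E1' E2 m :
  wf_tree E2 -> reduces E1 E1' m -> reduces (EBin c E1 E2) (EBin c E1' E2) m.
Proof.
move=> w2 red; split=> /=.
- by rewrite (reduces_Sh red).
- by apply/permP => a; have /permP/(_ a) := reduces_eigen red; rewrite !count_cat; lia.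
- by move=> x /(reduces_fst red) xE; rewrite mem_cat xE.
- by move=> x; rewrite !mem_cat => /orP[/(reduces_vars red)->|->]; rewrite ?orbT.
- by have := reduces_size red; lia.
- by move=> r U; rewrite (reduces_wf red U) wf_ren.
- move=> r v U; case: c => /=.
    by case/andP=> /(reduces_eval red U)-> ->.
  by case/orP=> [/(reduces_eval red U)->|->]; rewrite ?orbT.
- by move=> rho d /andP[r1 ->]; have [U ->] := reduces_ranked red r1.
Qed.

Lemma reduces_binr c E1 E2 E2' m :
  wf_tree E1 -> reduces E2 E2' m -> reduces (EBin c E1 E2) (EBin c E1 E2') m.
Proof.
move=> w1 red; split=> /=.
- by rewrite (reduces_Sh red).
- by apply/permP => a; have /permP/(_ a) := reduces_eigen red; rewrite !count_cat; lia.
- by move=> x /(reduces_fst red) xE; rewrite mem_cat xE orbT.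
- by move=> x; rewrite !mem_cat => /orP[->|/(reduces_vars red)->]; rewrite ?orbT.
- by have := reduces_size red; lia.
- by move=> r U; rewrite (reduces_wf red U) wf_ren.
- move=> r v U; case: c => /=.
    by case/andP=> -> /(reduces_eval red U)->.
  by case/orP=> [->|/(reduces_eval red U)->]; rewrite ?orbT.
- by move=> rho d /andP[-> r1]; have [U ->] := reduces_ranked red r1.
Qed.

Lemma reduces_all A y E E' m :
  wf_tree (EAll A y E) -> reduces E E' m -> reduces (EAll A y E) (EAll A y E') m.
Proof.
move=> /= /andP[/eqP e w] red; split=> //=.
- by rewrite perm_cons (reduces_eigen red).
- by move=> x /(reduces_fst red) xE; rewrite inE xE orbT.
- by move=> x; rewrite !inE => /orP[->|/(reduces_vars red)->]; rewrite ?orbT.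
- by rewrite ltnS (reduces_size red).
- move=> r U; rewrite (reduces_wf red U) Sh_ren (reduces_Sh red) e ren_inst.
  by rewrite eqxx.
- by move=> r v U; apply: (reduces_eval red U).
- by move=> rho d /andP[-> r1]; have [U ->] := reduces_ranked red r1.
Qed.

Lemma foldr_and_mem (T : Type) (p : T -> Prop) (s s1 s2 : seq T) (x : T) :
  foldr (fun y Q => p y /\ Q) True s -> s = s1 ++ x :: s2 -> p x.
Proof. by move=> + e; rewrite {s}e; elim: s1 => /= [[]|y s1 IH [_ /IH]]. Qed.

Definition treduces_spec (E : etree) (o : option (etree * (nat -> nat))) : Prop :=
  if o is Some (E', r) then exists2 m, r = repl m & reduces E E' m
  else is_etree E.

(** If no step applies, the instance terms of every existential node are distinct, which is all that
    [wf_tree] lacks of [is_etree]. *)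
Lemma merge1_treeP E : wf_tree E -> treduces_spec E (merge1_tree E).
Proof.
elim/etree_nested_ind: E => [b p ts|c E1 IH1 E2 IH2|A l IH|A y E IH] //.
- move=> /= /andP[w1 w2]; rewrite /treduces_spec /=.
  case: (merge1_tree E1) (IH1 w1) => [[E1' r] [m -> red]|e1].
    by exists m => //; apply: reduces_binl.
  case: (merge1_tree E2) (IH2 w2) => [[E2' r] [m -> red]|e2] /=.
    by exists m => //; apply: reduces_binr.
  by rewrite e1 e2.
- move=> w; rewrite /treduces_spec /=.
  move: (join_firstP (K := Defs_term__canonical__eqtype_Equality Fs Ps 0) fst
    (fun q q' : term 0 * etree => (q.1, merge_tree q.2 q'.2))
    (fun q q' => mgr q.2 q'.2) l).
  case: join_first => [[l' r]|ul].
    move=> [s1 [x [s2 [y [s3 [el -> exy ->]]]]]].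
    exists (matched x.2 y.2); first exact: mgr_repl.
    apply: list_reduces_ex => //; rewrite el in w *.
    move: w; rewrite /= all_cat /= all_cat /=.
    move=> /and4P[_ /andP[/eqP ex _] _ /andP[/andP[/eqP ey _] _]].
    (* Instances of one body at equal terms have equal shallow formulas, so joining by terms alone
       is legitimate. *)
    have e : Sh x.2 = Sh y.2 by rewrite ex ey exy.
    apply: ReducesJoin => //=.
    - by rewrite /key_ex exy e.
    - by rewrite /key_ex /= Sh_merge.
    - exact: merge_size.
  set f := (X in map_first X l); move: (map_firstP f l).
  case: (map_first f l) => [[l' r]|al] /=.
    move=> [s1 [x [s2 [x' [el -> fx]]]]].
    have wx : wf_tree x.2.
      by move: w; rewrite el /= all_cat /= => /and3P[_ /andP[]].
    move: fx (foldr_and_mem (x := x) (s1 := s1) (s2 := s2) IH el wx).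
    rewrite /f /treduces_spec; case: (merge1_tree x.2) => [[E' r']|] //=.
    move=> [<- <-] [m -> red].
    exists m => //; apply: list_reduces_ex => //; rewrite el in w *.
    apply: ReducesOne => //=; last exact: reduces_size red.
    by rewrite /key_ex /= (reduces_Sh red).
  rewrite ul /=; move: w => /=; rewrite !all_andb => /andP[-> wl] /=.
  elim: l IH al wl {ul} => //= q l IHl [IHq /IHl{}IHl].
  move=> /andP[fq /IHl{}IHl] /andP[wq /IHl->].
  rewrite andbT; move: fq (IHq wq); rewrite /f /treduces_spec.
  by case: (merge1_tree q.2).
- move=> /[dup] w /= /andP[e w0]; rewrite /treduces_spec /=.
  case: (merge1_tree E) (IH w0) => [[E' r] [m -> red]|e1] /=.
    by exists m => //; apply: reduces_all.
  by rewrite e e1.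
Qed.

(** * Normalization of pre-proofs *)

(** As a conjunction of its sides, a cut has the right deep formula, eigenvariables, addresses and
    merge steps, so the results on trees apply to it. *)
Definition cut_tree (C : cut Fs Ps) : etree := EBin Conj C.1 C.2.

Definition wf_cut (C : cut Fs Ps) : bool :=
  wf_tree (cut_tree C) && ((Sh C.1 == dual (Sh C.2)) && positive (Sh C.1)).

Definition wf_pre (P : preproof) : bool :=
  all wf_tree (trees P) && all wf_cut (cuts P).

Definition vars_pre (P : preproof) : seq nat :=
  flatten (map tree_vars (trees P))
  ++ flatten [seq fv (cut_formula C) ++ tree_vars (cut_tree C) | C <- cuts P].

Definition ranked_pre (rho : nat -> nat) (P : preproof) : bool :=
  all (ranked rho 0) (trees P)
  && all (fun C => ranked rho (rk rho (fv (cut_formula C))) (cut_tree C)) (cuts P).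

Lemma has_Dp_pre v (P : preproof) :
  has (eval v) (Dp_pre P) =
  has (fun E => eval v (Dp E)) (trees P)
  || has (fun C => eval v (Dp (cut_tree C))) (cuts P).
Proof. by rewrite /Dp_pre has_cat !has_map. Qed.

Record pre_reduces (P P' : preproof) (m : seq (nat * nat)) : Prop := PreReduces {
  pre_reduces_Sh : map (@Sh Fs Ps) (trees P') =i map (@Sh Fs Ps) (trees P);
  pre_reduces_eigen : perm_eq (eigen_pre P' ++ map snd m) (eigen_pre P);
  pre_reduces_fst : {subset map fst m <= eigen_pre P'};
  pre_reduces_vars : {subset vars_pre P' <= vars_pre P};
  pre_reduces_size : pre_size P' < pre_size P;
  pre_reduces_wf : forall r, unifies r m -> wf_pre (ren_pre r P');
  pre_reduces_eval : forall r v, unifies r m ->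
    has (eval v) (Dp_pre (ren_pre r P)) -> has (eval v) (Dp_pre (ren_pre r P'));
  pre_reduces_ranked : forall rho, ranked_pre rho P ->
    unifies rho m /\ ranked_pre rho P';
  pre_reduces_cuts : cuts P = [::] -> cuts P' = [::] }.

(** Both sides are recorded so that duality and positivity become conditions on keys. *)
Definition key_cut (C : cut Fs Ps) : formula 0 * formula 0 := (Sh C.1, Sh C.2).

Lemma wf_cut_ren r C : wf_cut C -> wf_cut (ren_tree r C.1, ren_tree r C.2).
Proof.
rewrite /wf_cut /= => /and3P[/andP[/(wf_ren r)-> /(wf_ren r)->]].
by rewrite !Sh_ren positive_ren => /eqP-> ->; rewrite ren_dual eqxx.
Qed.

Lemma wf_pre_ren r P : wf_pre P -> wf_pre (ren_pre r P).
Proof.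
rewrite /wf_pre /= !all_map => /andP[wT wC]; apply/andP; split.
  by apply: sub_all wT => E; apply: wf_ren.
by apply: sub_all wC => C; apply: wf_cut_ren.
Qed.

Lemma pre_reduces_trees P s m : wf_pre P ->
  list_reduces (@Sh Fs Ps) id (@tree_size Fs Ps) (trees P) s m ->
  pre_reduces P (Preproof (cuts P) s) m.
Proof.
move=> w red; have /andP[wT _] := w; split=> //=.
- exact: list_reduces_key red.
- have : perm_eq (flatten (map (@eigen Fs Ps) s) ++ map snd m)
                  (flatten (map (@eigen Fs Ps) (trees P))).
    exact: list_reduces_eigen red wT.
  move=> /permP p; apply/permP => a; have := p a.
  by rewrite /eigen_pre /= !count_cat; lia.
- by move=> x /(list_reduces_fst red) h; rewrite mem_cat h.
- move=> x; rewrite !mem_cat => /orP[|->]; last by rewrite orbT.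
  by move=> /(list_reduces_vars (lab := fun=> [::]) red) ->.
- by rewrite /pre_size /= ltn_add2r (list_reduces_size red).
- move=> r U; move: w => /(wf_pre_ren r)/andP[_ /= wC].
  by rewrite /wf_pre /= wC andbT all_map (list_reduces_wf red).
- move=> r v U; rewrite !has_Dp_pre /= !has_map.
  by case/orP=> [/(list_reduces_eval red wT U)->|->]; rewrite ?orbT.
- move=> rho /andP[rT rC]; rewrite /ranked_pre /= rC andbT.
  (* There is no variable above the root of a tree outside the cuts, and the empty context has rank
     0. *)
  have e : (fun E => ranked rho (maxn (rk rho ((fun=> [::]) (Sh E))) 0) (id E))
      =1 ranked rho 0 by move=> E; rewrite /rk big_nil.
  rewrite -(eq_all e); apply: (list_reduces_ranked (lab := fun=> [::]) red).
  by rewrite (eq_all e).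
Qed.

Lemma pre_reduces_cuts_of P s m : wf_pre P ->
  list_reduces key_cut cut_tree (fun C => (tree_size C.1 + tree_size C.2)%N)
    (cuts P) s m ->
  pre_reduces P (Preproof s (trees P)) m.
Proof.
move=> w red; have /andP[_] := w; rewrite all_andb => /andP[wC kC]; split=> //=.
- have : perm_eq (flatten [seq eigen C.1 ++ eigen C.2 | C <- s] ++ map snd m)
                  (flatten [seq eigen C.1 ++ eigen C.2 | C <- cuts P]).
    exact: list_reduces_eigen red wC.
  move=> /permP p; apply/permP => a; have := p a.
  by rewrite /eigen_pre /= !count_cat; lia.
- by move=> x /(list_reduces_fst red) h; rewrite mem_cat h orbT.
- move=> x; rewrite !mem_cat => /orP[->//|].
  by move=> /(list_reduces_vars (lab := fun k => fv k.1) red) ->; rewrite orbT.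
- by rewrite /pre_size /= ltn_add2l (list_reduces_size red).
- move=> r U; move: w => /(wf_pre_ren r)/andP[/= wT _].
  rewrite /wf_pre /= wT /= all_map.
  have {kC}: all (fun k => (k.1 == dual k.2) && positive k.1) (map key_cut s).
    by rewrite (eq_all_r (list_reduces_key red)) all_map.
  rewrite all_map => kC; have wC' := list_reduces_wf red wC U.
  have : all (fun C => wf_tree (ren_tree r (cut_tree C))
      && ((Sh C.1 == dual (Sh C.2)) && positive (Sh C.1))) s.
    by rewrite all_andb wC' kC.
  apply: sub_all => C /= /andP[wC1 /andP[/eqP e p]].
  by rewrite /wf_cut /= wC1 !Sh_ren e ren_dual eqxx -ren_dual -e positive_ren.
- move=> r v U; rewrite !has_Dp_pre /= !has_map.
  by case/orP=> [->//|/(list_reduces_eval red wC U)->]; rewrite orbT.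
- move=> rho /andP[rT rC]; rewrite /ranked_pre /= rT /=.
  have e : (fun C => ranked rho (maxn (rk rho (fv (key_cut C).1)) 0) (cut_tree C))
      =1 (fun C => ranked rho (rk rho (fv (cut_formula C))) (cut_tree C)).
    by move=> C; rewrite maxn0.
  rewrite -(eq_all e); apply: (list_reduces_ranked (lab := fun k => fv k.1) red).
  by rewrite (eq_all e).
(* No step is possible in an empty list of cuts, since the total size decreases. *)
- by move=> c0; have := list_reduces_size red; rewrite c0 ltn0.
Qed.

Definition all_merged (P : preproof) : bool :=
  [&& all (@is_etree Fs Ps) (trees P), all (@is_cut Fs Ps) (cuts P),
      uniq (map (@cut_formula Fs Ps) (cuts P)) & uniq (map (@Sh Fs Ps) (trees P))].

(** The failure of each of the four searches in [merge1] supplies one component of [all_merged]. *)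
Lemma merge1P P : wf_pre P ->
  (exists P' m, merge1 P = ren_pre (repl m) P' /\ pre_reduces P P' m)
  \/ merge1 P = P /\ all_merged P.
Proof.
move=> w; have /andP[wT wC] := w; rewrite /merge1.
case: join_first (join_firstP (@Sh Fs Ps) (@merge_tree Fs Ps) (@mgr Fs Ps) (trees P)).
  move=> [s r] [s1 [x [s2 [y [s3 [es -> exy ->]]]]]]; left.
  exists (Preproof (cuts P) (s1 ++ merge_tree x y :: s2 ++ s3)), (matched x y).
  rewrite mgr_repl; split=> //; apply: pre_reduces_trees => //; rewrite es.
  by apply: ReducesJoin => //; rewrite ?Sh_merge ?merge_size.
move=> uT; case: join_first (join_firstP (@cut_formula Fs Ps)
   (fun C D => (merge_tree C.1 D.1, merge_tree C.2 D.2))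
   (fun C D => mgr C.1 D.1 \o mgr C.2 D.2) (cuts P)).
  move=> [s r] [s1 [x [s2 [y [s3 [es -> exy ->]]]]]]; left.
  exists (Preproof (s1 ++ (merge_tree x.1 y.1, merge_tree x.2 y.2) :: s2 ++ s3)
    (trees P)), (matched (cut_tree x) (cut_tree y)).
  rewrite !mgr_repl /= repl_cat; split=> //; apply: pre_reduces_cuts_of => //.
  move: wC; rewrite es all_cat /= all_cat /=.
  move=> /and4P[_ /andP[_ /andP[/eqP ex _]] _ /andP[/andP[_ /andP[/eqP ey _]] _]].
  (* Only the cut-formulas were compared; the other sides agree because duality is an involution. *)
  have e2 : Sh x.2 = Sh y.2.
    by rewrite -[LHS]dualK -ex -[RHS]dualK -ey; congr dual.
  rewrite /cut_formula in exy.
  apply: ReducesJoin; rewrite /key_cut /= ?Sh_merge ?exy ?e2 //.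
  by have := merge_size x.1 y.1; have := merge_size x.2 y.2; lia.
move=> uC; case: map_first (map_firstP (@merge1_tree Fs Ps) (trees P)).
  move=> [s r] [s1 [x [s2 [x' [es -> fx]]]]]; left.
  have wx : wf_tree x by move: wT; rewrite es all_cat /= => /and3P[].
  have := merge1_treeP wx; rewrite fx => -[m -> red].
  exists (Preproof (cuts P) (s1 ++ x' :: s2)), m; split=> //.
  apply: pre_reduces_trees => //; rewrite es; apply: ReducesOne => //.
    by rewrite (reduces_Sh red).
  exact: reduces_size red.
move=> nT; case: map_first (map_firstP (@merge1_cut Fs Ps) (cuts P)).
  move=> [s r] [s1 [x [s2 [x' [es -> fx]]]]]; left.
  have /andP[wx _] : wf_cut x by move: wC; rewrite es all_cat /= => /and3P[].
  have := merge1_treeP wx.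
  have e : merge1_tree (cut_tree x) = Some (cut_tree x', r).
    move: fx; rewrite /merge1_cut /=.
    case: (merge1_tree x.1) => [[E1 r1] [<- <-]//|] /=.
    by case: (merge1_tree x.2) => [[E2 r2] /= [<- <-]//|] /=.
  rewrite e => -[m -> red].
  exists (Preproof (s1 ++ x' :: s2) (trees P)), m; split=> //.
  apply: pre_reduces_cuts_of => //; rewrite es; apply: ReducesOne => //.
    by have [e1 e2] := reduces_Sh red; rewrite /key_cut e1 e2.
  by have /= := reduces_size red; rewrite ltnS.
move=> nC; right; split=> //; rewrite /all_merged uT uC !andbT; apply/andP; split.
  have : all (fun E => wf_tree E && ~~ isSome (merge1_tree E)) (trees P).
    by rewrite all_andb wT.
  apply: sub_all => E /andP[/merge1_treeP]; rewrite /treduces_spec.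
  by case: merge1_tree.
have : all (fun C => wf_cut C && ~~ isSome (merge1_cut C)) (cuts P).
  by rewrite all_andb wC.
apply: sub_all => C /andP[/and3P[/andP[w1 w2] e p]]; rewrite /is_cut e p !andbT.
move: (merge1_treeP w1) (merge1_treeP w2); rewrite /treduces_spec /merge1_cut.
by case: (merge1_tree C.1) => [[]|->] //; case: (merge1_tree C.2) => [[]|->].
Qed.

Lemma pre_size_ren r (P : preproof) : pre_size (ren_pre r P) = pre_size P.
Proof.
rewrite /pre_size /= -!map_comp; congr (sumn _ + sumn _)%N; apply: eq_map => x /=.
  by rewrite tree_size_ren.
by rewrite !tree_size_ren.
Qed.

Lemma eigen_pre_ren r (P : preproof) : eigen_pre (ren_pre r P) = map r (eigen_pre P).
Proof.
rewrite /eigen_pre /= map_cat !map_flatten -!map_comp; congr (flatten _ ++ flatten _).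
  by apply: eq_map => E /=; rewrite eigen_ren.
by apply: eq_map => C /=; rewrite !eigen_ren map_cat.
Qed.

Lemma vars_pre_ren r (P : preproof) : vars_pre (ren_pre r P) = map r (vars_pre P).
Proof.
rewrite /vars_pre /= map_cat !map_flatten -!map_comp; congr (flatten _ ++ flatten _).
  by apply: eq_map => E /=; rewrite tree_vars_ren.
by apply: eq_map => C /=; rewrite !tree_vars_ren /cut_formula Sh_ren fv_ren !map_cat.
Qed.

Lemma ranked_pre_ren rho r (P : preproof) :
  rho \o r =1 rho -> ranked_pre rho (ren_pre r P) = ranked_pre rho P.
Proof.
move=> e; rewrite /ranked_pre /= !all_map; congr (_ && _); apply: eq_all => x /=.
  by rewrite ranked_ren.
by rewrite !ranked_ren // /cut_formula Sh_ren fv_ren rk_map (eq_rk (rho2 := rho)).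
Qed.

Lemma has_Dp_pre_ren v r (P : preproof) :
  has (eval v) (Dp_pre (ren_pre r P)) =
  has (eval (fun p ts => v p (map (ren_term r) ts))) (Dp_pre P).
Proof.
rewrite !has_Dp_pre /= !has_map; congr (_ || _); apply: eq_has => x /=.
  by rewrite eval_Dp_ren.
by rewrite !eval_Dp_ren.
Qed.

(** The invariant of a normalization that starts from [Q]; the ranking [rho] stays the same
    throughout. *)
Record refines (rho : nat -> nat) (Q P : preproof) : Prop := Refines {
  refines_wf : wf_pre P;
  refines_uniq : uniq (eigen_pre P);
  refines_ranked : ranked_pre rho P;
  refines_taut : tautology (Dp_pre P);
  refines_Sh : map (@Sh Fs Ps) (trees P) =i map (@Sh Fs Ps) (trees Q);
  refines_eigen : {subset eigen_pre P <= eigen_pre Q};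
  refines_vars : {subset vars_pre P <= vars_pre Q};
  refines_cuts : cuts Q = [::] -> cuts P = [::] }.

Lemma eigen_tree_vars (E : etree) : {subset eigen E <= tree_vars E}.
Proof.
elim/etree_nested_ind: E => [b p ts|c E1 IH1 E2 IH2|A l IH|A y E IH] //= x.
- by rewrite !mem_cat => /orP[/IH1|/IH2] ->; rewrite ?orbT.
- elim: l IH => //= q l IHl [IHq /IHl{}IHl].
  by rewrite !mem_cat => /orP[/IHq|/IHl] ->; rewrite ?orbT.
- by rewrite !inE => /orP[->|/IH->]; rewrite ?orbT.
Qed.

Lemma eigen_vars_pre (P : preproof) : {subset eigen_pre P <= vars_pre P}.
Proof.
move=> x; rewrite /eigen_pre /vars_pre !mem_cat => /orP[h|h]; apply/orP; [left|right].
  elim: (trees P) h => //= E s IH; rewrite !mem_cat.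
  by case/orP=> [/eigen_tree_vars|/IH] ->; rewrite ?orbT.
elim: (cuts P) h => //= C s IH; rewrite !mem_cat.
by case/orP=> [/orP[]/eigen_tree_vars|/IH] ->; rewrite ?orbT.
Qed.

(** Freshness keeps lost eigenvariables out of the shallow sequent, which the renaming therefore
    leaves unchanged. The uniqueness of eigenvariables separates kept from lost ones, so that
    [repl m] does unify [m]. *)
Lemma refines_step rho Q P P' m :
  {in eigen_pre Q, forall x, x \notin fv_seq (Sh_pre Q)} ->
  refines rho Q P -> pre_reduces P P' m -> refines rho Q (ren_pre (repl m) P').
Proof.
move=> fresh [w u rk_P taut eSh sE sV c0] red.
have pm := pre_reduces_eigen red.
have : uniq (eigen_pre P' ++ map snd m) by rewrite (perm_uniq pm).
rewrite cat_uniq => /and3P[uP' dis um].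
have out : {in eigen_pre P', forall x, x \notin map snd m}.
  by move=> x xP'; apply: contra dis => xm; apply/hasP; exists x.
have U : unifies (repl m) m.
  by apply: repl_unifies => // x /(pre_reduces_fst red)/out.
have sP' : {subset eigen_pre P' <= eigen_pre P}.
  by move=> x xP'; rewrite -(perm_mem pm) mem_cat xP'.
have [Urho rP'] := pre_reduces_ranked red rk_P.
(* The lost eigenvariables have already disappeared from [P'], and the renaming moves no other
   variable. *)
have eE : eigen_pre (ren_pre (repl m) P') = eigen_pre P'.
  rewrite eigen_pre_ren -[RHS]map_id; apply/eq_in_map => x /out.
  exact: repl_out.
split.
- exact: (pre_reduces_wf red U).
- by rewrite eE.
- by rewrite ranked_pre_ren //; apply: repl_comp.
- by move=> v; apply: (pre_reduces_eval red U); rewrite has_Dp_pre_ren.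
- have eS : map (@Sh Fs Ps) (trees (ren_pre (repl m) P')) = map (@Sh Fs Ps) (trees P').
    rewrite /= -map_comp (eq_map (Sh_ren _)) [LHS](map_comp (ren _)) -[RHS]map_id.
    apply/eq_in_map => A AP'; apply: ren_id => x xA; apply: repl_out.
    apply/negP => xm; have xQ : x \in eigen_pre Q.
      by apply: sE; rewrite -(perm_mem pm) mem_cat xm orbT.
    move: (fresh x xQ) => /fv_seqP[]; exists A => //.
    by rewrite in_fset /= -eSh -(pre_reduces_Sh red).
  by move=> A; rewrite eS (pre_reduces_Sh red) eSh.
- by move=> x; rewrite eE => /sP'/sE.
- move=> x; rewrite vars_pre_ren => /mapP[y /(pre_reduces_vars red) yP ->].
  case: (repl_in m y) => [->|/(pre_reduces_fst red)/sP'/sE]; first exact: sV.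
  exact: eigen_vars_pre.
- by move=> /c0/(pre_reduces_cuts red) /= ->.
Qed.

Lemma refines_normalize rho Q :
  {in eigen_pre Q, forall x, x \notin fv_seq (Sh_pre Q)} ->
  wf_pre Q -> uniq (eigen_pre Q) -> ranked_pre rho Q -> tautology (Dp_pre Q) ->
  refines rho Q (normalize Q) /\ all_merged (normalize Q).
Proof.
move=> fresh w u rQ taut; rewrite /normalize.
have H : forall n P, pre_size P <= n -> refines rho Q P ->
    refines rho Q (iter n (@merge1 Fs Ps) P) /\ all_merged (iter n (@merge1 Fs Ps) P).
  elim=> [|n IH] P sP rP.
    split=> //; case: (merge1P (refines_wf rP)) => [[P' [m [_ red]]]|[] //].
    by have := pre_reduces_size red; lia.
  rewrite iterSr; case: (merge1P (refines_wf rP)) => [[P' [m [-> red]]]|[e pP]].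
    apply: IH; last exact: refines_step red.
    by rewrite pre_size_ren; have := pre_reduces_size red; lia.
  (* A fixed point may be reached early; the remaining iterations do nothing. *)
  rewrite e; suff -> : iter n (@merge1 Fs Ps) P = P by [].
  by elim: (n) => //= k ->.
by apply: H => //; split.
Qed.

Lemma mem_flatten_map (T : Type) (S : eqType) (f : T -> seq S) s x :
  (x \in flatten (map f s)) = has (fun t => x \in f t) s.
Proof. by elim: s => //= t s IH; rewrite mem_cat IH. Qed.

Lemma has_all (T : Type) (a b : pred T) s :
  has a s -> all b s -> exists2 t, a t & b t.
Proof.
elim: s => //= t s IH /orP[at_|/IH{}IH] /andP[bt bs]; [by exists t|exact: IH].
Qed.

(** * Existence of rankings *)

(** The rank equations in flat form: each eigenvariable comes with the list of variables above it,
    where [p] is the initial context. *)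
Fixpoint paths (p : seq nat) (E : etree) : seq (nat * seq nat) :=
  match E with
  | ELit _ _ _ => [::]
  | EBin _ E1 E2 => paths p E1 ++ paths p E2
  | EEx _ l => flatten (map (fun q => paths (fv_term q.1 ++ p) q.2) l)
  | EAll _ y E0 => (y, p) :: paths (y :: p) E0
  end.

Definition paths_pre (P : preproof) : seq (nat * seq nat) :=
  flatten (map (paths [::]) (trees P))
  ++ flatten [seq paths (fv (cut_formula C)) (cut_tree C) | C <- cuts P].

Lemma rk_cat rho s1 s2 : rk rho (s1 ++ s2) = maxn (rk rho s1) (rk rho s2).
Proof. by rewrite /rk big_cat. Qed.

Lemma ranked_paths rho p (E : etree) :
  ranked rho (rk rho p) E = all (fun yp => rho yp.1 == (rk rho yp.2).+1) (paths p E).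
Proof.
elim/etree_nested_ind: E p => [b q ts|c E1 IH1 E2 IH2|A l IH|A y E IH] p //=.
- by rewrite all_cat IH1 IH2.
- elim: l IH => //= q l IHl [IHq /IHl->].
  by rewrite all_cat -IHq rk_cat.
(* Since [rho y] exceeds the rank of [p], adding [y] to the context raises the maximum to exactly
   [rho y]. *)
- rewrite -IH; case: eqP => //= e; congr ranked.
  by rewrite {2}/rk big_cons -/(rk rho p) e; lia.
Qed.

Lemma ranked_pre_paths rho P :
  ranked_pre rho P = all (fun yp => rho yp.1 == (rk rho yp.2).+1) (paths_pre P).
Proof.
rewrite /ranked_pre /paths_pre all_cat; congr (_ && _).
  elim: (trees P) => //= E s ->; rewrite all_cat -ranked_paths.
  by rewrite /rk big_nil.
elim: (cuts P) => //= C s ->.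
by rewrite all_cat -(ranked_paths _ _ (cut_tree C)).
Qed.

Lemma paths_eigen p (E : etree) : map fst (paths p E) = eigen E.
Proof.
elim/etree_nested_ind: E p => [b q ts|c E1 IH1 E2 IH2|A l IH|A y E IH] p //=.
- by rewrite map_cat IH1 IH2.
- by elim: l IH => //= q l IHl [IHq /IHl <-]; rewrite map_cat IHq.
- by rewrite IH.
Qed.

Lemma paths_pre_eigen P : map fst (paths_pre P) = eigen_pre P.
Proof.
rewrite /paths_pre /eigen_pre map_cat !map_flatten -!map_comp.
congr (flatten _ ++ flatten _); apply: eq_map => x /=.
  by rewrite paths_eigen.
exact: (paths_eigen _ (cut_tree x)).
Qed.

Lemma paths_cat p q (E : etree) :
  paths (p ++ q) E = [seq (yp.1, yp.2 ++ q) | yp <- paths p E].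
Proof.
elim/etree_nested_ind: E p => [b r ts|c E1 IH1 E2 IH2|A l IH|A y E IH] p //=.
- by rewrite map_cat IH1 IH2.
- by elim: l IH => //= r l IHl [IHr /IHl->]; rewrite catA map_cat IHr.
- by rewrite -cat_cons IH.
Qed.

Lemma paths_vars p (E : etree) y q x :
  (y, q) \in paths p E -> x \in q -> x \in p ++ tree_vars E.
Proof.
elim/etree_nested_ind: E p => [b r ts|c E1 IH1 E2 IH2|A l IH|A z E IH] p //=.
- by rewrite !mem_cat => /orP[/IH1 IH|/IH2 IH] /IH;
    rewrite mem_cat => /orP[] ->; rewrite ?orbT.
- elim: l IH => //= r l IHl [IHr /IHl{}IHl].
  rewrite !mem_cat => /orP[/IHr{}IHr /IHr|/IHl{}IHl /IHl]; rewrite !mem_cat.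
    by case/orP=> [/orP[]|] ->; rewrite ?orbT.
  by case/orP=> ->; rewrite ?orbT.
- rewrite inE => /orP[/eqP[_ ->]|/IH{}IH /IH]; first by rewrite mem_cat => ->.
  by rewrite !mem_cat !inE; case: (x == z); rewrite ?orbT.
Qed.

Lemma paths_pre_vars P y q x :
  (y, q) \in paths_pre P -> x \in q -> x \in vars_pre P.
Proof.
rewrite /paths_pre /vars_pre !mem_cat !mem_flatten_map => h xq.
case/orP: h => [h|h]; apply/orP; [left|right]; apply: sub_has h => E yE.
  exact: paths_vars yE xq.
exact: paths_vars yE xq.
Qed.

(** Well-foundedness of the dependencies between eigenvariables. Variables that are not
    eigenvariables are unconstrained, so rankings of independent parts can be combined and contexts
    enlarged by such variables. *)
Definition wranked (L : seq (nat * seq nat)) : Prop :=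
  exists rho : nat -> nat, forall y p x,
    (y, p) \in L -> x \in p -> x \in map fst L -> rho x < rho y.

Lemma ranked_wranked rho P : ranked_pre rho P -> wranked (paths_pre P).
Proof.
rewrite ranked_pre_paths => /allP h; exists rho => y p x /h/eqP /= -> xp _.
by rewrite ltnS leq_rk.
Qed.

(* The equations of [ranked_pre] are solved by iterating them; the value at an
   eigenvariable is stable after as many steps as its weak rank. *)
Lemma wranked_exact L : uniq (map fst L) -> wranked L ->
  exists rho, all (fun yp => rho yp.1 == (rk rho yp.2).+1) L.
Proof.
move=> uL [w hw].
(* One round of the equations. The eigenvariables in [L] being distinct, [index] finds the only path
   of [y]; all other variables get rank 0. *)
pose f rho y := if y \in map fst L
  then (rk rho (nth [::] (map snd L) (index y (map fst L)))).+1 else 0.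
have fE rho y p : (y, p) \in L -> f rho y = (rk rho p).+1.
  move=> yp; rewrite /f (map_f fst yp); congr (rk _ _).+1.
  have iL : index (y, p) L < size L by rewrite index_mem.
  have -> : index y (map fst L) = index (y, p) L.
    rewrite -[in LHS](_ : nth 0 (map fst L) (index (y, p) L) = y).
      by rewrite index_uniq // size_map.
    by rewrite (nth_map (y, p)) // nth_index.
  by rewrite (nth_map (y, p)) // nth_index.
pose r n := iter n f (fun=> 0).
have r0 n x : x \notin map fst L -> r n x = 0.
  by case: n => //= n xL; rewrite /f (negbTE xL).
have stable n y : y \in map fst L -> w y < n -> r n.+1 y = r n y.
  elim: n y => // n IH _ /mapP[[y p] yp ->] /= wy.
  rewrite -[LHS]/(f (r n.+1) y) -[RHS]/(f (r n) y) !(fE _ _ _ yp); congr _.+1.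
  apply: eq_rk => x xp; case: (boolP (x \in map fst L)) => xL; last first.
    by rewrite !r0.
  by apply: IH => //; have := hw _ _ _ yp xp xL; lia.
(* After this many rounds the values at all eigenvariables are stable. *)
pose n := (rk w (map fst L)).+1; exists (r n); apply/allP => -[y p] yp.
have yL : y \in map fst L := map_f fst yp.
have e : r n.+1 y = r n y by apply: stable; rewrite // ltnS leq_rk.
by apply/eqP; rewrite -[LHS]e; apply: fE.
Qed.

Lemma wranked_ranked (P : preproof) :
  uniq (eigen_pre P) -> wranked (paths_pre P) -> exists rho, ranked_pre rho P.
Proof.
rewrite -paths_pre_eigen => u /(wranked_exact u)[rho h].
by exists rho; rewrite ranked_pre_paths.
Qed.

(** * Acyclicity *)

Notation step := (step Fs Ps).
Notation node := (node Fs Ps).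

Definition step_rk rho (s : step) : nat :=
  match s with
  | SEx t => rk rho (fv_term t)
  | SAll y => rho y
  | SCut A => rk rho (fv A)
  | _ => 0
  end.

Definition node_rk rho (v : node) : nat := \max_(s <- v) step_rk rho s.

Definition is_all (v : node) : bool :=
  if last (SLeft Fs Ps) v is SAll _ then true else false.

Lemma node_rk_cons rho s v :
  node_rk rho (s :: v) = maxn (step_rk rho s) (node_rk rho v).
Proof. by rewrite /node_rk big_cons. Qed.

Lemma node_rk_rcons rho s v :
  node_rk rho (rcons v s) = maxn (node_rk rho v) (step_rk rho s).
Proof. by rewrite /node_rk -cats1 big_cat big_seq1. Qed.

(** The variables on the address [w] are those above [y] inside [E]; together with the outer
    context, of rank [c], they are what the equation for [y] ranges over. *)
Lemma expansions_all rho c (E : etree) w y :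
  ranked rho c E -> rcons w (SAll _ _ y) \in expansions E ->
  maxn c (node_rk rho w) < rho y.
Proof.
elim/etree_nested_ind: E c w => [b r ts|d E1 IH1 E2 IH2|A l IH|A z E IH] c w //=.
- move=> /andP[/IH1{}IH1 /IH2{}IH2]; rewrite mem_cat.
  case/orP=> /mapP[v vE]; case: w => [|s w] //= [-> e]; rewrite -e in vE.
    by rewrite node_rk_cons max0n; apply: IH1.
  by rewrite node_rk_cons max0n; apply: IH2.
- elim: l IH => //= -[t E] l IHl [IHE /IHl{}IHl] /andP[/IHE{}IHE /IHl{}IHl].
  rewrite inE mem_cat => /or3P[/eqP|/mapP[v vE]|/IHl//]; case: w {IHl} => [|s w] //=.
    by case: w.
  case=> -> e; rewrite -e in vE; have := IHE _ vE.
  by rewrite node_rk_cons /=; lia.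
- move=> /andP[/eqP e /IH{}IH]; rewrite inE => /orP[/eqP|/mapP[v vE]].
    by case: w => [[->]|s [|//]//]; rewrite e /node_rk big_nil; lia.
  case: w => [[-> _]|s w /= [-> e1]]; first by rewrite e /node_rk big_nil; lia.
  rewrite -e1 in vE; have := IH _ vE.
  by rewrite node_rk_cons /= e; lia.
Qed.

(** Consequently the rank of a universal expansion is the rank of its eigenvariable. *)
Lemma nodes_all rho P w y :
  ranked_pre rho P -> rcons w (SAll _ _ y) \in nodes P -> node_rk rho w < rho y.
Proof.
move=> /andP[rT rC]; rewrite /nodes mem_cat !mem_flatten_map.
case/orP=> [/has_all/(_ rT)[E /mapP[v vE]]|/has_all/(_ rC)[C]].
  case: w => [|s w] //= [-> e] rE; rewrite -e in vE.
  by have := expansions_all rE vE; rewrite node_rk_cons /=; lia.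
rewrite inE => /orP[/eqP|/mapP[v]]; first by case: w => [|? []].
have -> : map (cons (SLeft Fs Ps)) (expansions C.1)
  ++ map (cons (SRight Fs Ps)) (expansions C.2) = expansions (cut_tree C) by [].
move=> vC e rE; case: w e => [|s w] //= [-> e]; rewrite -e in vC.
by have := expansions_all rE vC; rewrite node_rk_cons /=; lia.
Qed.

(* Of two nodes with equal rank, a universal expansion precedes the existential
   expansions and cuts that contain its eigenvariable. *)
Definition node_measure rho (v : node) : nat := ((node_rk rho v).*2 + ~~ is_all v)%N.

(** When a cut or an existential expansion has the same rank as an existential expansion below it,
    the length of the address decides. *)
Definition node_lt rho (v w : node) : bool :=
  (node_measure rho v < node_measure rho w)
  || ((node_measure rho v == node_measure rho w) && (size v < size w)).

Lemma is_all_rcons v s : is_all (rcons v s) = if s is SAll _ then true else false.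
Proof. by rewrite /is_all last_rcons. Qed.

Lemma prefix_lt rho P (v w : node) : ranked_pre rho P ->
  w \in nodes P -> prefix v w -> v != w -> node_lt rho v w.
Proof.
move=> rP + /prefixP[u e]; case/lastP: u e => [|u s ->].
  by rewrite cats0 => ->; rewrite eqxx.
rewrite -rcons_cat => wP _; rewrite /node_lt /node_measure is_all_rcons.
have le_v : node_rk rho v <= node_rk rho (v ++ u).
  by rewrite /node_rk big_cat leq_maxl.
rewrite size_rcons size_cat node_rk_rcons.
(* A universal expansion lacks the increment in the measure that its predecessor may have; the
   strict bound of [nodes_all] makes up for this. *)
case: s wP => [||t|y|A|A] wP /=; try have := nodes_all rP wP.
all: move: le_v; move: (node_rk rho v) (node_rk rho (v ++ u)) (size v) (size u).
all: by case: is_all => /=; lia.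
Qed.

(** Each generating dependency goes up in the transitive and irreflexive relation [node_lt]. The
    address of a cut is a prefix of those of its expansions, so that case reduces to domination. *)
Lemma ranked_acyclic rho P : ranked_pre rho P -> acyclic P.
Proof.
move=> rP v; suff H u w : dep P u w -> node_lt rho u w.
  by move=> /H; rewrite /node_lt !ltnn andbF.
elim=> [u' w'|u' v' w' _ h1 _ h2]; last first.
  by move: h1 h2; rewrite /node_lt; lia.
case=> {u w u' w'} [u y w t uP wP yt|u w uP wP|A w _ wP w0|u y A uP AP yA].
- have h := nodes_all rP uP; have le_y := leq_rk rho yt.
  rewrite /node_lt /node_measure !is_all_rcons !node_rk_rcons /=; lia.
- exact: prefix_lt rP wP.
- apply: prefix_lt rP wP _ _; first by rewrite /= eqxx prefix0s.
  by apply: contra w0 => /eqP[<-].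
- have h := nodes_all rP uP; have le_y := leq_rk rho yA.
  rewrite /node_lt /node_measure is_all_rcons node_rk_rcons /is_all /=.
  by rewrite [node_rk rho [:: _]]big_seq1 /=; lia.
Qed.

(** * Pre-proofs of the inferences *)

Lemma is_etree_wf (E : etree) : is_etree E -> wf_tree E.
Proof.
elim/etree_nested_ind: E => [b p ts|c E1 IH1 E2 IH2|A l IH|A y E IH] //=.
- by move=> /andP[/IH1-> /IH2->].
- case/andP=> _; elim: l IH => //= q l IHl [IHq /IHl{}IHl].
  by case/andP=> /andP[-> /IHq->] /IHl->.
- by case/andP=> -> /IH->.
Qed.

(* In the inductive proof, [eg] and [vs] are the eigenvariables and the variables
   of an LK-proof, and the interval from [k] to [k'] holds the variables created
   by coercions. *)
Record sound (k k' : nat) (eg vs : seq nat) (P : preproof) : Prop := Sound {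
  sound_leq : k <= k';
  sound_wf : wf_pre P;
  sound_uniq : uniq (eigen_pre P);
  sound_wranked : wranked (paths_pre P);
  sound_eigen : {in eigen_pre P, forall x, (x \in eg) || (k <= x < k')};
  sound_vars : {in vars_pre P, forall x, (x \in vs) || (k <= x < k')} }.

Lemma eigen_pre_cat (P Q : preproof) :
  perm_eq (eigen_pre (cat_pre P Q)) (eigen_pre P ++ eigen_pre Q).
Proof.
apply/permP => a; rewrite /eigen_pre /cat_pre /= !flatten_map_cat !count_cat; lia.
Qed.

Lemma vars_pre_cat (P Q : preproof) x :
  (x \in vars_pre (cat_pre P Q)) = (x \in vars_pre P) || (x \in vars_pre Q).
Proof.
by rewrite /vars_pre /cat_pre /= !flatten_map_cat !mem_cat orbACA.
Qed.

Lemma paths_pre_cat (P Q : preproof) yp :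
  (yp \in paths_pre (cat_pre P Q)) = (yp \in paths_pre P) || (yp \in paths_pre Q).
Proof.
by rewrite /paths_pre /cat_pre /= !flatten_map_cat !mem_cat orbACA.
Qed.

Lemma wf_pre_cat (P Q : preproof) : wf_pre (cat_pre P Q) = wf_pre P && wf_pre Q.
Proof. by rewrite /wf_pre /cat_pre /= !all_cat andbACA. Qed.

(** No dependency crosses from one part to the other, as neither contains an eigenvariable of the
    other; each part keeps its own ranking. *)
Lemma wranked_cat_pre (P Q : preproof) :
  {in eigen_pre P, forall x, x \notin vars_pre Q} ->
  {in eigen_pre Q, forall x, x \notin vars_pre P} ->
  wranked (paths_pre P) -> wranked (paths_pre Q) -> wranked (paths_pre (cat_pre P Q)).
Proof.
move=> dP dQ [rP hP] [rQ hQ].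
exists (fun x => if x \in eigen_pre P then rP x else rQ x) => y p x.
rewrite paths_pre_eigen (perm_mem (eigen_pre_cat P Q)) paths_pre_cat.
move=> yp xp; rewrite mem_cat => xe; have ey (L : preproof) :
    (y, p) \in paths_pre L -> y \in eigen_pre L.
  by rewrite -paths_pre_eigen => /(map_f fst).
case/orP: yp => yp; have xv := paths_pre_vars yp xp; rewrite ?(ey _ yp).
  have xP : x \in eigen_pre P.
    by case/orP: xe => // /dQ; rewrite xv.
  by rewrite xP; apply: hP yp xp _; rewrite paths_pre_eigen.
have xQ : x \in eigen_pre Q.
  by case/orP: xe => // /dP; rewrite xv.
have nP z : z \in eigen_pre Q -> (z \in eigen_pre P) = false.
  by move=> /dQ h; apply: contraNF h; apply: eigen_vars_pre.
by rewrite !nP ?(ey _ yp) //; apply: hQ yp xp _; rewrite paths_pre_eigen.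
Qed.

(** Variables of LK-proofs lie below [k] and the coercions of the two parts use consecutive
    intervals, so a clash could only be one between the LK-proofs themselves. *)
Lemma sound_cat k k1 k2 eg1 vs1 eg2 vs2 P1 P2 :
  {in vs1, forall x, x < k} -> {in vs2, forall x, x < k} ->
  {subset eg1 <= vs1} -> {subset eg2 <= vs2} ->
  {in eg1, forall x, x \notin vs2} -> {in eg2, forall x, x \notin vs1} ->
  sound k k1 eg1 vs1 P1 -> sound k1 k2 eg2 vs2 P2 ->
  sound k k2 (eg1 ++ eg2) (vs1 ++ vs2) (cat_pre P1 P2).
Proof.
move=> lt1 lt2 s1 s2 d1 d2 [kk1 w1 u1 r1 e1 v1] [k12 w2 u2 r2 e2 v2].
have D1 : {in eigen_pre P1, forall x, x \notin vars_pre P2}.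
  move=> x /e1 xP; apply/negP => /v2; case/orP: xP => [xe|xk].
    by rewrite (negbTE (d1 _ xe)) => ?; have := lt1 _ (s1 _ xe); lia.
  by case/orP=> [/lt2|]; lia.
have D2 : {in eigen_pre P2, forall x, x \notin vars_pre P1}.
  move=> x /e2 xP; apply/negP => /v1; case/orP: xP => [xe|xk].
    by rewrite (negbTE (d2 _ xe)) => ?; have := lt2 _ (s2 _ xe); lia.
  by case/orP=> [/lt1|]; lia.
split.
- lia.
- by rewrite wf_pre_cat w1.
- rewrite (perm_uniq (eigen_pre_cat _ _)) cat_uniq u1 u2 andbT /=.
  apply/hasPn => x /D2; apply: contra; exact: eigen_vars_pre.
- exact: wranked_cat_pre.
- move=> x; rewrite (perm_mem (eigen_pre_cat _ _)) 2!mem_cat => h.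
  by case/orP: h => [/e1|/e2] /orP[->|]; rewrite ?orbT //; lia.
- move=> x; rewrite vars_pre_cat => h; rewrite mem_cat.
  by case/orP: h => [/v1|/v2] /orP[->|]; rewrite ?orbT //; lia.
Qed.

(** For existential, propositional and cut inferences: [Q] rearranges [S], and contexts grow at most
    by [q], the variables of the new term or cut-formula. These are not eigenvariables, so the old
    ranking still works. *)
Lemma sound_ext k k' eg vs eg' vs' q (S Q : preproof) :
  sound k k' eg vs S -> wf_pre Q -> perm_eq (eigen_pre Q) (eigen_pre S) ->
  (forall y p, (y, p) \in paths_pre Q ->
     exists2 p', (y, p') \in paths_pre S & {subset p <= p' ++ q}) ->
  {in q, forall x, x < k /\ x \notin eg} ->
  {in vars_pre Q, forall x, (x \in vars_pre S) || (x \in vs')} ->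
  {subset eg <= eg'} -> {subset vs <= vs'} -> sound k k' eg' vs' Q.
Proof.
move=> [kk w u [rho h] e v] wQ pQ pathQ qk vQ seg svs; split=> //.
- by rewrite (perm_uniq pQ).
- exists rho => y p x /pathQ[p' yp' spp'] /spp'; rewrite mem_cat.
  rewrite paths_pre_eigen (perm_mem pQ) => /orP[xp' xS|/qk[xk xeg] /e].
    by apply: h yp' xp' _; rewrite paths_pre_eigen.
  by rewrite (negbTE xeg); lia.
- by move=> x; rewrite (perm_mem pQ) => /e/orP[/seg->|->]; rewrite ?orbT.
- by move=> x /vQ/orP[/v/orP[/svs->|->]|->]; rewrite ?orbT.
Qed.

Lemma sound_all k k' eg vs eg' vs' a (S Q : preproof) :
  sound k k' eg vs S -> wf_pre Q -> perm_eq (eigen_pre Q) (a :: eigen_pre S) ->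
  (forall y p, (y, p) \in paths_pre Q -> (y, p) = (a, [::]) \/
     exists2 p', (y, p') \in paths_pre S & {subset p <= p' ++ [:: a]}) ->
  a < k -> a \notin eg ->
  {in vars_pre Q, forall x, (x \in vars_pre S) || (x \in vs')} ->
  {subset a :: eg <= eg'} -> {subset vs <= vs'} -> sound k k' eg' vs' Q.
Proof.
move=> [kk w u [rho h] e v] wQ pQ pathQ ak aeg vQ seg svs.
have aS : a \notin eigen_pre S.
  by apply/negP => /e; rewrite (negbTE aeg); lia.
split=> //.
- by rewrite (perm_uniq pQ) /= aS.
(* The new universal expansion is a root and depends on nothing: it takes rank 0 and all other ranks
   move up. *)
- exists (fun x => if x == a then 0 else (rho x).+1) => y p x.
  move=> /pathQ[[_ ->]//|[p' yp' spp']] /spp'; rewrite mem_cat inE.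
  have yS : y \in eigen_pre S by rewrite -paths_pre_eigen (map_f fst yp').
  have ya : y != a by apply: contraNneq aS => <-.
  rewrite (negbTE ya) paths_pre_eigen (perm_mem pQ) inE.
  case: eqP => //= _; rewrite orbF => xp' xS.
  by rewrite ltnS; apply: h yp' xp' _; rewrite paths_pre_eigen.
- move=> x; rewrite (perm_mem pQ) inE => /orP[/eqP->|/e/orP[xe|->]].
  + by rewrite seg ?mem_head.
  + by rewrite seg // inE xe orbT.
  + by rewrite orbT.
- by move=> x /vQ/orP[/v/orP[/svs->|->]|->]; rewrite ?orbT.
Qed.

(** Coercions contain no instance terms and number their eigenvariables upwards from the root, so
    the identity ranks them. *)
Lemma coerce_recP m (A : formula m) s k :
  let: (E, k') := coerce_rec A s k in
  [/\ Sh E = subst s A, is_etree E, k <= k' & uniq (eigen E)] /\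
  {in tree_vars E, forall x, k <= x < k'} /\
  forall p, {in p, forall x, x < k} ->
    forall y q x, (y, q) \in paths p E -> x \in q -> x < y.
Proof.
elim: A s k => {}m => [b q ts|c A IHA B IHB|A IHA|A IHA] s k //=.
- case: (coerce_rec A s k) (IHA s k) => E1 k1 [[e1 i1 l1 u1] [v1 p1]].
  case: (coerce_rec B s k1) (IHB s k1) => E2 k2 [[e2 i2 l2 u2] [v2 p2]] /=.
  split; [split|split].
  + by rewrite e1 e2.
  + by rewrite i1.
  + lia.
  + rewrite cat_uniq u1 u2 andbT /=; apply/hasPn => x /eigen_tree_vars/v2 xk.
    by apply/negP => /eigen_tree_vars/v1; lia.
  + by move=> x; rewrite mem_cat => /orP[/v1|/v2]; lia.
  + move=> p pk y q x; rewrite mem_cat => /orP[/p1|/p2]; apply=> // z /pk; lia.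
- move: (IHA (scons (FVar Fs 0 k) s) k.+1).
  case: coerce_rec => E k' [[e i l u] [v P]] /=; split; [split|split] => //.
  + by rewrite e inst_subst_up eqxx.
  + lia.
  + by rewrite u andbT; apply/negP => /eigen_tree_vars/v; lia.
  + by move=> x; rewrite inE => /orP[/eqP->|/v]; lia.
  + move=> p pk y q x; rewrite inE => /orP[/eqP[-> ->] /pk //|].
    by apply: P => z; rewrite inE => /orP[/eqP->//|/pk]; lia.
Qed.

Lemma sound_coerce_seq s k :
  let: (Es, k') := coerce_seq s k in
  [/\ map (@Sh Fs Ps) Es = s, all (@is_etree Fs Ps) Es
    & sound k k' [::] [::] (Preproof [::] Es)].
Proof.
elim: s k => [|A s IH] k /=; first by split=> //; split=> //; exists id.
rewrite /coerce; case: coerce_rec (coerce_recP A (@BVar Fs 0) k) => E k1.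
move=> [[e i l u] [v p]]; case: coerce_seq (IH k1) => Es k2 [eEs iEs sEs].
have sE : sound k k1 [::] [::] (one_tree E).
  split=> //.
  - by rewrite /wf_pre /= is_etree_wf.
  - by rewrite /eigen_pre /= !cats0.
  - exists id => y q x; rewrite /paths_pre /= !cats0 => yq xq _.
    by apply: p yq xq.
  - by move=> x; rewrite /eigen_pre /= !cats0 => /eigen_tree_vars/v.
  - by move=> x; rewrite /vars_pre /= !cats0 => /v.
split; first by rewrite /= eEs e subst_id.
  by rewrite /= i iEs.
exact: (sound_cat _ _ _ _ _ _ sE sEs).
Qed.

Lemma split_has (T : Type) (a : pred T) s :
  has a s -> exists s1 x s2, s = s1 ++ x :: s2 /\ a x.
Proof.
elim: s => //= x s IH /orP[ax|/IH[s1 [y [s2 [-> ay]]]]].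
  by exists [::], x, s.
by exists (x :: s1), y, s2.
Qed.

Lemma filter_key (T : Type) (K : eqType) (key : T -> K) (a : K) s :
  a \notin map key s ->
  [seq x <- s | key x == a] = [::] /\ [seq x <- s | key x != a] = s.
Proof.
elim: s => //= x s IH; rewrite inE negb_or => /andP[ax /IH[-> ->]].
by rewrite eq_sym (negbTE ax).
Qed.

Lemma mem_Sh_pre (P : preproof) A : (A \in Sh_pre P) = (A \in map (@Sh Fs Ps) (trees P)).
Proof. by rewrite /Sh_pre in_fset. Qed.

(** Shallow formulas being distinct, [E] is the only tree for [A]; [ds] is either empty or the
    coercion that stands for [A] in the context. *)
Lemma extractP A G (P : preproof) k :
  uniq (map (@Sh Fs Ps) (trees P)) -> Sh_pre P = A |` G ->
  let: (E, P', k') := extract A G P k in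
  exists s1 s2 ds,
    [/\ trees P = s1 ++ E :: s2, P' = Preproof (cuts P) (s1 ++ s2 ++ ds), Sh E = A,
        sound k k' [::] [::] (Preproof [::] ds)
      & Sh_pre P' = G /\ uniq (map (@Sh Fs Ps) (trees P'))].
Proof.
move=> uP eP; rewrite /extract.
have : A \in map (@Sh Fs Ps) (trees P) by rewrite -mem_Sh_pre eP !inE eqxx.
rewrite -has_pred1 has_map => /split_has[s1 [E [s2 [es /= /eqP eE]]]].
have := uP; rewrite es map_cat cat_uniq /= eE => /and4P[u1 /norP[A1 d12] A2 u2].
have [f1 g1] := filter_key A1; have [f2 g2] := filter_key A2.
have := sound_coerce_seq [:: A] k; rewrite /=.
case: (coerce A k) => D k' [eD _ sD].
exists s1, s2, (if A \in G then [:: D] else [::]).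
rewrite !filter_cat /= f1 g1 f2 g2 eE eqxx /= -catA; split=> //.
  (* A coercion that is discarded still advances the counter. *)
  by case: ifP => // _; case: sD => ? *; split=> //; exists id.
have ed : map (@Sh Fs Ps) (if A \in G then [:: D] else [::]) =
    if A \in G then [:: A] else [::] by case: ifP eD.
split.
  apply/fsetP => B; rewrite mem_Sh_pre /= !map_cat ed !mem_cat.
  have := congr1 (fun X : {fset _} => B \in X) eP.
  rewrite mem_Sh_pre es map_cat /= mem_cat !inE eE.
  case: (eqVneq B A) => [->|BA] /=.
    by rewrite (negbTE A1) (negbTE A2) /=; case: ifP; rewrite ?inE ?eqxx.
  by case: ifP => _ <-; rewrite ?inE ?(negbTE BA) ?orbF.
rewrite /= !map_cat ed catA cat_uniq cat_uniq u1 u2 d12 /=.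
by case: ifP => //= _; rewrite orbF andbT mem_cat negb_or A1.
Qed.

Lemma Sh_pre_cat (P Q : preproof) : Sh_pre (cat_pre P Q) = Sh_pre P `|` Sh_pre Q.
Proof. by apply/fsetP => A; rewrite in_fsetU !mem_Sh_pre /= map_cat mem_cat. Qed.

Lemma Sh_pre_one_tree E : Sh_pre (one_tree E : preproof) = [fset Sh E].
Proof. by apply/fsetP => A; rewrite mem_Sh_pre !inE. Qed.

Record expands (k k' : nat) (eg vs : seq nat) (G : sequent Fs Ps) (P : preproof) :
    Prop := Expands {
  expands_sound : sound k k' eg vs P;
  expands_taut : tautology (Dp_pre P);
  expands_merged : all_merged P;
  expands_Sh : Sh_pre P = G }.

Lemma expands_uniq k k' eg vs G P :
  expands k k' eg vs G P -> uniq (map (@Sh Fs Ps) (trees P)).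
Proof. by case=> _ _ /and4P[]. Qed.

Lemma expands_normalize k k' eg vs G Q :
  sound k k' eg vs Q -> tautology (Dp_pre Q) -> Sh_pre Q = G ->
  {in fv_seq G, forall x, x < k} -> {in eg, forall x, x \notin fv_seq G} ->
  expands k k' eg vs G (normalize Q)
  /\ (cuts Q = [::] -> cuts (normalize Q) = [::]).
Proof.
move=> [kk w u r e v] taut eG Gk Geg.
have [rho rQ] := wranked_ranked u r.
have [|[wP uP rP tP SP eP vP cP] pP] := refines_normalize _ w u rQ taut.
  move=> x /e; rewrite eG => /orP[/Geg//|xk].
  by apply/negP => /Gk; lia.
split=> //; split=> //.
  split=> //.
  - exact: ranked_wranked rP.
  - by move=> x /eP/e.
  - by move=> x /vP/v.
by rewrite -eG; apply/fsetP => A; rewrite !mem_Sh_pre SP.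
Qed.

(** * Regular LK-proofs *)

Implicit Type G : sequent Fs Ps.

Lemma fv_lk_vars G (pi : LK G) : {subset fv_seq G <= lk_vars pi}.
Proof. by move=> x xG; case: pi xG => *; rewrite mem_cat; apply/orP; left. Qed.

Lemma occurs_outside_fv G (pi : LK G) x : x \in fv_seq G -> occurs_outside x pi.
Proof. by case: pi => * /=; apply/orP; left. Qed.

Lemma lk_eigen_vars G (pi : LK G) : {subset lk_eigen pi <= lk_vars pi}.
Proof.
move=> x; elim: pi => {G} //= [G A a n pi IH|G A t pi IH|G A B pi1 IH1 pi2 IH2
  |G A B pi IH|G A pi1 IH1 pi2 IH2]; rewrite ?(mem_cat, inE).
- by case/orP=> [->|/IH->]; rewrite ?orbT.
- by move/IH=> ->; rewrite !orbT.
- by case/orP=> [/IH1|/IH2] ->; rewrite !orbT.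
- by move/IH=> ->; rewrite !orbT.
- by case/orP=> [/IH1|/IH2] ->; rewrite !orbT.
Qed.

(** This separates the premises of a binary inference: an eigenvariable of one proof that occurs in
    the other would be an eigenvariable twice or occur outside its inference, both against
    regularity. *)
Lemma lk_vars_outside G (pi : LK G) x :
  x \in lk_vars pi -> (x \in lk_eigen pi) || occurs_outside x pi.
Proof.
elim: pi => {G} /= [G p ts|G A a n pi IH|G A t pi IH|G A B pi1 IH1 pi2 IH2
  |G A B pi IH|G A pi1 IH1 pi2 IH2]; rewrite ?(mem_cat, inE).
- by rewrite !orbF.
- by case: (x == a) => //=; lia.
- by case/or3P=> [->|->|/IH/orP[] ->]; rewrite ?orbT.
- by case/or3P=> [->|/IH1/orP[] ->|/IH2/orP[] ->]; rewrite ?orbT.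
- by case/orP=> [->|/IH/orP[] ->]; rewrite ?orbT.
- by case/or3P=> [->|/IH1/orP[] ->|/IH2/orP[] ->]; rewrite ?orbT.
Qed.

Lemma regular_all G A a n (pi : LK (inst A (FVar Fs 0 a) |` G)) :
  regular (LKall n pi) ->
  [/\ regular pi, a \notin lk_eigen pi
    & {in a :: lk_eigen pi, forall x, x \notin fv_seq (All A |` G)}].
Proof.
rewrite /regular /= eqxx orbF n /= => /andP[/andP[an u] /allP H].
rewrite u an; split=> //.
  by apply/allP => x xpi; move: (H x xpi); case: eqP xpi an => [->->|] //=; lia.
by move=> x; rewrite inE => /orP[/eqP->//|/H/norP[]].
Qed.

Lemma regular_ex G A t (pi : LK (inst A t |` (Ex A |` G))) :
  regular (LKex pi) ->
  [/\ regular pi, {in lk_eigen pi, forall x, x \notin fv_seq (Ex A |` G)}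
    & {in lk_eigen pi, forall x, x \notin fv_term t}].
Proof.
rewrite /regular /= => /andP[u /allP H]; rewrite u; split.
- by apply/allP => x /H; lia.
- by move=> x /H; lia.
- by move=> x /H; lia.
Qed.

Lemma regular_and G A B (pi1 : LK (A |` G)) (pi2 : LK (B |` G)) :
  regular (LKand pi1 pi2) ->
  [/\ regular pi1 /\ regular pi2,
      {in lk_eigen pi1 ++ lk_eigen pi2, forall x, x \notin fv_seq (Bin Conj A B |` G)},
      {in lk_eigen pi1, forall x, x \notin lk_vars pi2}
    & {in lk_eigen pi2, forall x, x \notin lk_vars pi1}].
Proof.
rewrite /regular /= cat_uniq => /andP[/and3P[-> /hasPn u ->]].
rewrite all_cat => /andP[/allP H1 /allP H2]; split=> /=.
- by split; [apply/allP => x /H1|apply/allP => x /H2]; lia.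
- by move=> x; rewrite mem_cat => /orP[/H1|/H2]; lia.
- move=> x x1; apply/negP => /lk_vars_outside/orP[/u|xo]; first by rewrite x1.
  by move: (H1 x x1); rewrite xo !orbT.
- move=> x x2; apply/negP => /lk_vars_outside/orP[x1|xo].
    by move: (u x x2); rewrite x1.
  by move: (H2 x x2); rewrite xo !orbT.
Qed.

(** Freshness has to include the cut-formula, which the conclusion lacks; it is obtained from the
    end-sequent of [pi1], for the eigenvariables of both proofs. *)
Lemma regular_cut G A (pi1 : LK (A |` G)) (pi2 : LK (dual A |` G)) :
  regular (LKcut pi1 pi2) ->
  [/\ regular pi1 /\ regular pi2,
      {in lk_eigen pi1 ++ lk_eigen pi2, forall x, x \notin fv_seq (A |` G)},
      {in lk_eigen pi1, forall x, x \notin lk_vars pi2}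
    & {in lk_eigen pi2, forall x, x \notin lk_vars pi1}].
Proof.
rewrite /regular /= cat_uniq => /andP[/and3P[-> /hasPn u ->]].
rewrite all_cat => /andP[/allP H1 /allP H2]; split=> /=.
- by split; [apply/allP => x /H1|apply/allP => x /H2]; lia.
- move=> x; rewrite mem_cat => h; apply/negP => /(occurs_outside_fv pi1) xo.
  by case/orP: h => [/H1|/H2]; rewrite xo orbT.
- move=> x x1; apply/negP => /lk_vars_outside/orP[/u|xo]; first by rewrite x1.
  by move: (H1 x x1); rewrite xo !orbT.
- move=> x x2; apply/negP => /lk_vars_outside/orP[x1|xo].
    by move: (u x x2); rewrite x1.
  by move: (H2 x x2); rewrite xo !orbT.
Qed.

Lemma regular_or G A B (pi : LK (A |` (B |` G))) :
  regular (LKor pi) ->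
  regular pi /\ {in lk_eigen pi, forall x, x \notin fv_seq (Bin Disj A B |` G)}.
Proof.
rewrite /regular /= => /andP[-> /allP H]; split; first by apply/allP => x /H; lia.
by move=> x /H; lia.
Qed.

(** * Soundness of the single inferences *)

Lemma sound_fresh k k0 k' (eg vs : seq nat) (P : preproof) ds :
  {in vs, forall x, x < k} -> {subset eg <= vs} ->
  sound k k0 eg vs P -> sound k0 k' [::] [::] (Preproof [::] ds) ->
  sound k k' eg vs (cat_pre P (Preproof [::] ds)).
Proof.
move=> vk sev sP sds; rewrite -[eg]cats0 -[vs]cats0.
by apply: sound_cat sP sds.
Qed.

Lemma sound_fresh_cat k0 k1 k2 (ds1 ds2 : seq etree) :
  sound k0 k1 [::] [::] (Preproof [::] ds1) ->
  sound k1 k2 [::] [::] (Preproof [::] ds2) ->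
  sound k0 k2 [::] [::] (Preproof [::] (ds1 ++ ds2)).
Proof. by move=> s1 s2; apply: (sound_cat _ _ _ _ _ _ s1 s2). Qed.

Lemma mem_paths_cat q (E : etree) y p :
  (y, p) \in paths q E ->
  exists2 p', (y, p') \in paths [::] E & {subset p <= p' ++ q}.
Proof.
rewrite -[q]cat0s paths_cat => /mapP[[z p'] zp [-> ->]].
by exists p'.
Qed.

Lemma tautology_mem (v : Ps -> seq (term 0) -> bool) (P : preproof) :
  tautology (Dp_pre P) ->
  has (fun E => eval v (Dp E)) (trees P)
  || has (fun C => eval v (Dp (cut_tree C))) (cuts P).
Proof. by move=> /(_ v); rewrite has_Dp_pre. Qed.

Definition Exp_spec G (pi : LK G) (k : nat) : Prop :=
  let: (P, k') := Exp_rec pi k in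
  expands k k' (lk_eigen pi) (lk_vars pi) G P /\ (lk_cut_free pi -> cuts P = [::]).

Ltac and_tauto :=
  intros; repeat match goal with H : is_true (_ && _) |- _ => case/andP: H; intros end;
  by repeat (apply/andP; split).

Ltac or_tauto :=
  rewrite ?in_nil ?orbF; repeat case/orP; by move=> ->; rewrite ?orbT.

Lemma eqb_imp (a b : bool) : a = b -> a -> b. Proof. by move->. Qed.

(** For disjunction, where two trees are extracted in succession: [e] carries a property from one
    decomposition of the remaining trees to the other. *)
Ltac or_tauto_with e :=
  rewrite ?in_nil ?orbF; repeat case/orP; let h := fresh in move=> h;
  first [by rewrite h ?orbT | move: e; rewrite h ?orbT => /(_ isT); or_tauto].

Let flE := (flatten_map_cat, flatten_map_cons, mem_cat, count_cat).

Lemma Exp_init G p ts k : Exp_spec (LKinit G p ts) k.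
Proof.
rewrite /Exp_spec /=; set s := enum_fset _.
case: coerce_seq (sound_coerce_seq s k) => Es k' [eEs iEs sEs].
have mem_s A : (A \in s) = (A \in Lit true p ts |` (Lit false p ts |` G)) by [].
split=> //; split.
- case: sEs => ? ? ? ? e v; split=> //.
  by move=> x /v /orP[//|h]; apply/orP; right.
- move=> v; rewrite has_Dp_pre /= orbF.
  have H b : Lit b p ts \in s -> v p ts == b -> has (fun E => eval v (Dp E)) Es.
    rewrite -eEs -has_pred1 has_map => h vb; apply: sub_has h => E /= /eqP.
    by case: E => //= b' p' ts' [-> -> ->].
  have [vp|vp] := boolP (v p ts); [apply: (H true)|apply: (H false)];
    by rewrite ?mem_s ?inE ?eqxx ?orbT ?eqbF_neg ?vp.
- by rewrite /all_merged /= iEs eEs fset_uniq.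
- by apply/fsetP => A; rewrite mem_Sh_pre /= eEs mem_s.
Qed.

Lemma Exp_all G A a n (pi : LK (inst A (FVar Fs 0 a) |` G)) k :
  regular (LKall n pi) -> {in lk_vars (LKall n pi), forall x, x < k} ->
  Exp_spec pi k -> Exp_spec (LKall n pi) k.
Proof.
move=> /regular_all[reg an fresh] vk; rewrite /Exp_spec /=.
have {}vk x : (x \in fv_seq (All A |` G)) || (x \in a :: lk_vars pi) -> x < k.
  by rewrite -mem_cat; apply: vk.
case: (Exp_rec pi k) => [[c s] k0] [exP cf].
move: (extractP k0 (expands_uniq exP) (expands_Sh exP)).
case: (extract _ _ _ _) => [[E P'] k'] [s1 [s2 [ds [/= es -> eE sds [eG _]]]]].
subst s; case: exP => sP tP _ _.
(* The premise together with the coercions serves as the reference against which the conclusion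
   before merging is compared. *)
have sS : sound k k' (lk_eigen pi) (lk_vars pi)
    (cat_pre (Preproof c (s1 ++ E :: s2)) (Preproof [::] ds)).
  apply: sound_fresh sP sds; last exact: lk_eigen_vars.
  by move=> x xv; apply: vk; rewrite inE xv !orbT.
set Q := cat_pre _ (one_tree _).
have sQ : sound k k' (a :: lk_eigen pi) (fv_seq (All A |` G) ++ a :: lk_vars pi) Q.
  apply: (sound_all (a := a) sS) => //.
  - have := sound_wf sS; rewrite /wf_pre /= !all_cat /= eE eqxx; and_tauto.
  - apply/permP => q; rewrite /eigen_pre /= !flE /= ?cats0; lia.
  - move=> y p; rewrite /paths_pre /= !flE /= ?cats0 in_cons => h.
    have [/eqP->|/mem_paths_cat[p' yp' sp]|yp] : [\/ (y, p) == (a, [::]),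
        (y, p) \in paths [:: a] E | (y, p) \in paths_pre
        (cat_pre (Preproof c (s1 ++ s2)) (Preproof [::] ds))].
    + rewrite /paths_pre /= !flE /= ?cats0; apply/or3P; move: h; or_tauto.
    + by left.
    + by right; exists p'; rewrite // !flE yp' !orbT.
    + right; exists p; last by move=> x; rewrite mem_cat => ->.
      by move: yp; rewrite /paths_pre /= !flE /= ?cats0; or_tauto.
  - by apply: vk; rewrite mem_head orbT.
  - move=> x; rewrite /vars_pre /= !flE /= ?cats0 !inE; or_tauto.
  - by move=> x xv; rewrite mem_cat inE xv !orbT.
have [|||| ex cc] := expands_normalize (G := All A |` G) sQ.
- move=> v; have := tautology_mem v tP.
  by rewrite has_Dp_pre /= !has_cat /= ?has_cat /=; or_tauto.
- by rewrite Sh_pre_cat eG Sh_pre_one_tree fsetUC.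
- by move=> x xG; apply: vk; rewrite xG.
- exact: fresh.
by split=> // /cf /= c0; apply: cc; rewrite /= c0.
Qed.

Lemma Exp_ex G A t (pi : LK (inst A t |` (Ex A |` G))) k :
  regular (LKex pi) -> {in lk_vars (LKex pi), forall x, x < k} ->
  Exp_spec pi k -> Exp_spec (LKex pi) k.
Proof.
move=> /regular_ex[reg fresh nt] vk; rewrite /Exp_spec /=.
have {}vk x :
    (x \in fv_seq (Ex A |` G)) || ((x \in fv_term t) || (x \in lk_vars pi)) -> x < k.
  by rewrite -!mem_cat; apply: vk.
case: (Exp_rec pi k) => [[c s] k0] [exP cf].
move: (extractP k0 (expands_uniq exP) (expands_Sh exP)).
case: (extract _ _ _ _) => [[E P'] k'] [s1 [s2 [ds [/= es -> eE sds [eG _]]]]].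
subst s; case: exP => sP tP _ _.
have sS : sound k k' (lk_eigen pi) (lk_vars pi)
    (cat_pre (Preproof c (s1 ++ E :: s2)) (Preproof [::] ds)).
  apply: sound_fresh sP sds; last exact: lk_eigen_vars.
  by move=> x xv; apply: vk; rewrite xv !orbT.
set E' := EEx A [:: (t, E)].
have [wE' sE' nE'] : [/\ wf_tree E' = wf_tree E, Sh E' = Ex A & eigen E' = eigen E].
  by rewrite /= eE eqxx andbT cats0.
have [vE' pE' dE'] : [/\ tree_vars E' = fv_term t ++ tree_vars E,
    paths [::] E' = paths (fv_term t) E & forall v, eval v (Dp E') = eval v (Dp E)].
  by rewrite /= !cats0; split=> // v; rewrite orbF.
(* The tree is known through these equations from now on, which prevents simplification from
   unfolding it. *)
clearbody E'; set Q := cat_pre _ (one_tree _).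
have sQ : sound k k' (lk_eigen pi) (fv_seq (Ex A |` G) ++ fv_term t ++ lk_vars pi) Q.
  apply: (sound_ext (q := fv_term t) sS) => //.
  - have := sound_wf sS; rewrite /wf_pre /= !all_cat /= wE'; and_tauto.
  - apply/permP => q; rewrite /eigen_pre /= !flE nE' /= ?cats0; lia.
  - move=> y p; rewrite /paths_pre /= !flE pE' /= ?cats0 => h.
    have [/mem_paths_cat[p' yp' sp]|yp] : (y, p) \in paths (fv_term t) E \/
      (y, p) \in paths_pre (cat_pre (Preproof c (s1 ++ s2)) (Preproof [::] ds)).
    + rewrite /paths_pre /= !flE /= ?cats0; apply/orP; move: h; or_tauto.
    + by exists p'; rewrite // !flE yp' !orbT.
    + exists p; last by move=> x; rewrite mem_cat => ->.
      by move: yp; rewrite /paths_pre /= !flE /= ?cats0; or_tauto.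
  - move=> x xt; split; first by apply: vk; rewrite xt orbT.
    by apply: contraL xt => /nt.
  - move=> x; rewrite /vars_pre /= !flE vE' /= !flE ?cats0; or_tauto.
  - by move=> x xv; rewrite !mem_cat xv !orbT.
have [|||| ex cc] := expands_normalize (G := Ex A |` G) sQ.
- move=> v; have := tautology_mem v tP.
  by rewrite has_Dp_pre /= !has_cat /= ?has_cat /= dE'; or_tauto.
- by rewrite Sh_pre_cat eG Sh_pre_one_tree sE' fsetUC fsetUA fsetUid.
- by move=> x xG; apply: vk; rewrite xG.
- exact: fresh.
by split=> // /cf /= c0; apply: cc; rewrite /= c0.
Qed.

Lemma Exp_or G A B (pi : LK (A |` (B |` G))) k :
  regular (LKor pi) -> {in lk_vars (LKor pi), forall x, x < k} ->
  Exp_spec pi k -> Exp_spec (LKor pi) k.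
Proof.
move=> /regular_or[reg fresh] vk; rewrite /Exp_spec /=.
have {}vk x : (x \in fv_seq (Bin Disj A B |` G)) || (x \in lk_vars pi) -> x < k.
  by rewrite -mem_cat; apply: vk.
case: (Exp_rec pi k) => [[c s] k0] [exP cf].
move: (extractP k0 (expands_uniq exP) (expands_Sh exP)).
case: (extract _ _ _ _) => [[E1 P1] k1] [s1 [s2 [ds1 [/= es eP1 eE1 sds1 [eG1 u1]]]]].
move: (extractP k1 u1 eG1).
case: (extract _ _ _ _) => [[E2 P2] k2] [u2 [u3 [ds2 [/= eu -> eE2 sds2 [eG _]]]]].
subst s P1; case: exP => sP tP _ _; rewrite /= in eu *.
have eq_fl (T : Type) (f : etree -> seq T) := congr1 (fun u => flatten (map f u)) eu.
have sS : sound k k2 (lk_eigen pi) (lk_vars pi)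
    (cat_pre (Preproof c (s1 ++ E1 :: s2)) (Preproof [::] (ds1 ++ ds2))).
  apply: (sound_fresh _ _ sP (sound_fresh_cat sds1 sds2)); last exact: lk_eigen_vars.
  by move=> x xv; apply: vk; rewrite xv orbT.
set Q := cat_pre _ (one_tree _).
have sQ : sound k k2 (lk_eigen pi) (fv_seq (Bin Disj A B |` G) ++ lk_vars pi) Q.
  apply: (sound_ext (q := [::]) sS) => //.
  - have := eqb_imp (congr1 (all (fun E => wf_tree E)) eu).
    have := sound_wf sS; rewrite /wf_pre /= !all_cat /= ?all_cat /=.
    case/andP=> /andP[/and3P[-> -> ->] /andP[-> ->]] -> /(_ isT).
    by and_tauto.
  - apply/permP => q; have := congr1 (count q) (eq_fl _ (@eigen Fs Ps)).
    rewrite /eigen_pre /= !flE /= ?cats0 -/(eigen E1) -/(eigen E2); lia.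
  - move=> y p h; exists p; last by move=> x; rewrite mem_cat => ->.
    have e := congr1 (fun L => (y, p) \in L) (eq_fl _ (fun E => paths [::] E)).
    move/esym/eqb_imp: e h; rewrite /Q /paths_pre /= !flE /= ?flE ?cats0 => e.
    or_tauto_with e.
  - move=> x; have e := congr1 (fun L => x \in L) (eq_fl _ (fun E => tree_vars E)).
    move/esym/eqb_imp: e; rewrite /Q /vars_pre /= !flE /= ?flE ?cats0 => e.
    or_tauto_with e.
  - by move=> x xv; rewrite mem_cat xv !orbT.
have [|||| ex cc] := expands_normalize (G := Bin Disj A B |` G) sQ.
- move=> v; have e := eqb_imp (congr1 (has (fun E => eval v (Dp E))) eu).
  have := tautology_mem v tP; move: e.
  rewrite has_Dp_pre /= !has_cat /= ?has_cat /= => e; or_tauto_with e.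
- by rewrite Sh_pre_cat eG Sh_pre_one_tree fsetUC /= eE1 eE2.
- by move=> x xG; apply: vk; rewrite xG.
- exact: fresh.
by split=> // /cf /= c0; apply: cc; rewrite /= c0.
Qed.

(** The second premise starts from the counter that the first one returns; hence its hypothesis
    covers all later values. *)
Lemma Exp_and G A B (pi1 : LK (A |` G)) (pi2 : LK (B |` G)) k :
  regular (LKand pi1 pi2) -> {in lk_vars (LKand pi1 pi2), forall x, x < k} ->
  Exp_spec pi1 k -> (forall k1, k <= k1 -> Exp_spec pi2 k1) ->
  Exp_spec (LKand pi1 pi2) k.
Proof.
move=> /regular_and[[reg1 reg2] fresh d1 d2] vk; rewrite /Exp_spec /=.
have {}vk x : (x \in fv_seq (Bin Conj A B |` G)) ||
    ((x \in lk_vars pi1) || (x \in lk_vars pi2)) -> x < k.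
  by rewrite -!mem_cat; apply: vk.
case: (Exp_rec pi1 k) => [[c1 s] k1] [ex1 cf1].
move=> /(_ k1 (sound_leq (expands_sound ex1))).
case: (Exp_rec pi2 k1) => [[c2 u] k2] [ex2 cf2].
move: (extractP k2 (expands_uniq ex1) (expands_Sh ex1)).
case: (extract _ _ _ _) => [[E1 P1] k3] [s1 [s2 [ds1 [/= es -> eE1 sds1 [eG1 _]]]]].
move: (extractP k3 (expands_uniq ex2) (expands_Sh ex2)).
case: (extract _ _ _ _) => [[E2 P2] k4] [u1 [u2 [ds2 [/= eu -> eE2 sds2 [eG2 _]]]]].
subst s u; case: ex1 => sP1 tP1 _ _; case: ex2 => sP2 tP2 _ _.
have v1 : {in lk_vars pi1, forall x, x < k}.
  by move=> x xv; apply: vk; rewrite xv ?orbT.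
have v2 : {in lk_vars pi2, forall x, x < k}.
  by move=> x xv; apply: vk; rewrite xv !orbT.
have s12 := sound_cat v1 v2 (@lk_eigen_vars _ pi1) (@lk_eigen_vars _ pi2) d1 d2 sP1 sP2.
have sS : sound k k4 (lk_eigen pi1 ++ lk_eigen pi2) (lk_vars pi1 ++ lk_vars pi2)
    (cat_pre (cat_pre (Preproof c1 (s1 ++ E1 :: s2)) (Preproof c2 (u1 ++ E2 :: u2)))
       (Preproof [::] (ds1 ++ ds2))).
  apply: (sound_fresh _ _ s12 (sound_fresh_cat sds1 sds2)) => x; rewrite ?mem_cat.
    by case/orP=> [/v1|/v2].
  by case/orP=> /lk_eigen_vars ->; rewrite ?orbT.
set Q := cat_pre _ (one_tree _).
have sQ : sound k k4 (lk_eigen pi1 ++ lk_eigen pi2)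
    (fv_seq (Bin Conj A B |` G) ++ lk_vars pi1 ++ lk_vars pi2) Q.
  apply: (sound_ext (q := [::]) sS) => //.
  - have := sound_wf sS; rewrite /wf_pre /= !all_cat /= ?all_cat /=; and_tauto.
  - apply/permP => q; rewrite /eigen_pre /= !flE /= ?flE ?cats0.
    by rewrite -/(eigen E1) -/(eigen E2); lia.
  - move=> y p h; exists p; last by move=> x; rewrite mem_cat => ->.
    by move: h; rewrite /paths_pre /= !flE /= ?flE ?cats0; or_tauto.
  - move=> x; rewrite /vars_pre /= !flE /= ?flE ?cats0; or_tauto.
  - by move=> x; rewrite !mem_cat => ->; rewrite !orbT.
have [|||| ex cc] := expands_normalize (G := Bin Conj A B |` G) sQ.
- move=> v; move: (tautology_mem v tP1) (tautology_mem v tP2).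
  rewrite has_Dp_pre /= !has_cat /= ?has_cat /=.
  (* If one conjunct is false, a remaining tree or cut of its premise is true. *)
  case: (eval v (Dp E1)) => /=; last by move=> + _; or_tauto.
  case: (eval v (Dp E2)) => /=; last by move=> _; or_tauto.
  by rewrite !orbT.
- by rewrite !Sh_pre_cat eG1 eG2 Sh_pre_one_tree /= eE1 eE2 fsetUid fsetUC.
- by move=> x xG; apply: vk; rewrite xG.
- exact: fresh.
by split=> // /andP[/cf1 /= c10 /cf2 /= c20]; apply: cc; rewrite /= c10 c20.
Qed.

Lemma Exp_cut G A (pi1 : LK (A |` G)) (pi2 : LK (dual A |` G)) k :
  regular (LKcut pi1 pi2) -> {in lk_vars (LKcut pi1 pi2), forall x, x < k} ->
  Exp_spec pi1 k -> (forall k1, k <= k1 -> Exp_spec pi2 k1) ->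
  Exp_spec (LKcut pi1 pi2) k.
Proof.
move=> /regular_cut[[reg1 reg2] fresh d1 d2] vk; rewrite /Exp_spec /=.
have {}vk x : (x \in fv_seq G) ||
    ((x \in lk_vars pi1) || (x \in lk_vars pi2)) -> x < k.
  by rewrite -!mem_cat; apply: vk.
case: (Exp_rec pi1 k) => [[c1 s] k1] [ex1 cf1].
move=> /(_ k1 (sound_leq (expands_sound ex1))).
case: (Exp_rec pi2 k1) => [[c2 u] k2] [ex2 cf2].
move: (extractP k2 (expands_uniq ex1) (expands_Sh ex1)).
case: (extract _ _ _ _) => [[E1 P1] k3] [s1 [s2 [ds1 [/= es -> eE1 sds1 [eG1 _]]]]].
move: (extractP k3 (expands_uniq ex2) (expands_Sh ex2)).
case: (extract _ _ _ _) => [[E2 P2] k4] [u1 [u2 [ds2 [/= eu -> eE2 sds2 [eG2 _]]]]].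
subst s u; case: ex1 => sP1 tP1 _ _; case: ex2 => sP2 tP2 _ _.
have v1 : {in lk_vars pi1, forall x, x < k}.
  by move=> x xv; apply: vk; rewrite xv ?orbT.
have v2 : {in lk_vars pi2, forall x, x < k}.
  by move=> x xv; apply: vk; rewrite xv !orbT.
have s12 := sound_cat v1 v2 (@lk_eigen_vars _ pi1) (@lk_eigen_vars _ pi2) d1 d2 sP1 sP2.
have sS : sound k k4 (lk_eigen pi1 ++ lk_eigen pi2) (lk_vars pi1 ++ lk_vars pi2)
    (cat_pre (cat_pre (Preproof c1 (s1 ++ E1 :: s2)) (Preproof c2 (u1 ++ E2 :: u2)))
       (Preproof [::] (ds1 ++ ds2))).
  apply: (sound_fresh _ _ s12 (sound_fresh_cat sds1 sds2)) => x; rewrite ?mem_cat.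
    by case/orP=> [/v1|/v2].
  by case/orP=> /lk_eigen_vars ->; rewrite ?orbT.
have fvA x : x \in fv A -> x \in lk_vars pi1.
  by move=> xA; apply: fv_lk_vars; rewrite fv_seq_fset1U xA.
set Q := if positive A then _ else _.
have sQ : sound k k4 (lk_eigen pi1 ++ lk_eigen pi2)
    (fv_seq G ++ lk_vars pi1 ++ lk_vars pi2) Q.
  (* The variables of the cut-formula come to stand above both sides of the new cut. They are the
     same for [A] and its dual, whichever is positive. *)
  apply: (sound_ext (q := fv A) sS) => //.
  - have := sound_wf sS; rewrite /Q /wf_pre; case: ifP => posA.
      by rewrite /= !all_cat /= ?all_cat /wf_cut /= eE1 eE2 dualK eqxx posA; and_tauto.
    rewrite /= !all_cat /= ?all_cat /wf_cut /= eE1 eE2 positive_dual posA eqxx.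
    by and_tauto.
  - apply/permP => q; rewrite /Q /eigen_pre.
    by case: ifP => _; rewrite /= !flE /= ?flE ?cats0; lia.
  - move=> y p h.
    have [/mem_paths_cat[p' yp' sp]|/mem_paths_cat[p' yp' sp]|yp] :
      [\/ (y, p) \in paths (fv A) E1, (y, p) \in paths (fv A) E2 | (y, p) \in paths_pre
        (cat_pre (Preproof c1 (s1 ++ s2 ++ ds1)) (Preproof c2 (u1 ++ u2 ++ ds2)))].
    + apply/or3P; move: h; rewrite /Q /paths_pre; case: ifP => _;
      rewrite /= /cut_formula /= ?eE1 ?eE2 ?fv_dual !flE /= ?flE ?cats0; or_tauto.
    + exists p' => //; move: yp'.
      by rewrite /paths_pre /= !flE /= ?flE ?cats0; or_tauto.
    + exists p' => //; move: yp'.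
      by rewrite /paths_pre /= !flE /= ?flE ?cats0; or_tauto.
    + exists p; last by move=> x; rewrite mem_cat => ->.
      by move: yp; rewrite /paths_pre /= !flE /= ?flE ?cats0; or_tauto.
  - move=> x xA; split; first by apply/v1/fvA.
    by apply: contraL xA => /fresh; rewrite fv_seq_fset1U => /norP[].
  - move=> x; rewrite /Q /vars_pre; case: ifP => _;
    rewrite /= /cut_formula /= ?eE1 ?eE2 ?fv_dual !flE /= ?flE ?cats0;
    have := fvA x; case: (x \in fv A) => [/(_ isT)->|_]; rewrite ?orbT //=; or_tauto.
  - by move=> x; rewrite !mem_cat => ->; rewrite !orbT.
have [|||| ex cc] := expands_normalize (G := G) sQ.
- move=> v; move: (tautology_mem v tP1) (tautology_mem v tP2).
  rewrite /Q has_Dp_pre; case: ifP => _; rewrite /= !has_cat /= ?has_cat /=;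
  (case: (eval v (Dp E1)) => /=; last by move=> + _; or_tauto);
  (case: (eval v (Dp E2)) => /=; last by move=> _; or_tauto);
  by rewrite ?orbT.
- have e0 C : Sh_pre (Preproof [:: C] [::] : preproof) = fset0.
    by apply/fsetP => B; rewrite mem_Sh_pre in_fset0.
  by rewrite /Q; case: ifP => _; rewrite !Sh_pre_cat eG1 eG2 e0 fset0U fsetUid.
- by move=> x xG; apply: vk; rewrite xG.
- by move=> x /fresh; rewrite fv_seq_fset1U => /norP[].
by split.
Qed.

Lemma Exp_recP G (pi : LK G) k :
  regular pi -> {in lk_vars pi, forall x, x < k} -> Exp_spec pi k.
Proof.
elim: pi k => {G} [G p ts|G A a n pi IH|G A t pi IH|G A B pi1 IH1 pi2 IH2
  |G A B pi IH|G A pi1 IH1 pi2 IH2] k reg vk.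
- exact: Exp_init.
- apply: Exp_all => //; have [reg' _ _] := regular_all reg.
  by apply: IH => // x xv; apply: vk; rewrite /= mem_cat inE xv !orbT.
- apply: Exp_ex => //; have [reg' _ _] := regular_ex reg.
  by apply: IH => // x xv; apply: vk; rewrite /= !mem_cat xv !orbT.
- have [[reg1 reg2] _ _ _] := regular_and reg; apply: Exp_and => //.
    by apply: IH1 => // x xv; apply: vk; rewrite /= !mem_cat xv !orbT.
  move=> k1 kk1; apply: IH2 => // x xv; apply: leq_trans kk1.
  by apply: vk; rewrite /= !mem_cat xv !orbT.
- apply: Exp_or => //; have [reg' _] := regular_or reg.
  by apply: IH => // x xv; apply: vk; rewrite /= mem_cat xv !orbT.
- have [[reg1 reg2] _ _ _] := regular_cut reg; apply: Exp_cut => //.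
    by apply: IH1 => // x xv; apply: vk; rewrite /= !mem_cat xv !orbT.
  move=> k1 kk1; apply: IH2 => // x xv; apply: leq_trans kk1.
  by apply: vk; rewrite /= !mem_cat xv !orbT.
Qed.

End ExpansionProofs.

Theorem theorem18 (Fs Ps : choiceType) (G : sequent Fs Ps) (pi : LK G) :
  closed_sequent G -> regular pi ->
  [/\ is_expansion_proof (Exp pi), Sh_pre (Exp pi) = G
    & lk_cut_free pi -> cut_free (Exp pi)].
Proof.
move=> closedG reg; rewrite /Exp /cut_free; set k := _.+1.
have vk : {in lk_vars pi, forall x, x < k}.
  by move=> x xv; rewrite ltnS; apply: leq_bigmax_seq.
have := Exp_recP reg vk; rewrite /Exp_spec.
case: Exp_rec => P k' /= [[sP tP /and4P[iT iC uC uT] eG] cf].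
(* Acyclicity is only now derived, from an exact ranking of the final pre-proof. *)
have [rho rP] := wranked_ranked (sound_uniq sP) (sound_wranked sP).
split=> //; split=> //; last exact: ranked_acyclic rP.
by split=> //; split; [exact: sound_uniq sP | rewrite eG].
Qed.
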